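(* Let $A\in\mathbb{R}^{m\times n}$ ($m\ge n$) have full column rank, and let $l > n$. Let $\Omega\in\mathbb{R}^{l\times m}$ have independent standard normal $\mathcal N(0,1)$ entries, and set $A_1 := \Omega A$. When $A_1$ has full column rank let $R_1$ be the upper triangular factor (positive diagonal) of a reduced QR decomposition of $A_1$ and $X := AR_1^{-1}$; otherwise set $\operatorname{cond}(X) := +\infty$. Then $$\mathbb{P}\left[\operatorname{cond}(X) \ge \frac{3 + \sqrt{n/l}}{1-\sqrt{n/l}}\right] \le 2\exp\!\left(-\frac{(\sqrt l - \sqrt n)^2}{8}\right).$$
   Context: For a full column rank matrix $M$, $\operatorname{cond}(M) = \sigma_{\max}(M)/\sigma_{\min}(M)$, the ratio of its largest and smallest (i.e. $n$-th) singular values. *)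

(* Defs.v *)
From HB Require Import structures.
From mathcomp Require Import all_boot all_order all_algebra.
From mathcomp Require Import all_classical all_reals all_analysis.
From mathcomp Require Import normal_distribution.
Set Implicit Arguments. Unset Strict Implicit. Unset Printing Implicit Defensive.
Import Order.TTheory GRing.Theory Num.Theory.
Local Open Scope classical_set_scope.
Local Open Scope ring_scope.

Section Defs.
Variable R : realType.

Definition vnorm (n : nat) (v : 'cV[R]_n) : R := Num.sqrt (\sum_i v i 0 ^+ 2).

Definition sigma_max (m n : nat) (M : 'M[R]_(m, n)) : R :=
  sup [set vnorm (M *m x) | x in [set x : 'cV[R]_n | vnorm x = 1]].

(* n-th (smallest) singular value of an m x n matrix with m >= n:
   sigma_min(M) = min_{|x|=1} |M x| *)
Definition sigma_min (m n : nat) (M : 'M[R]_(m, n)) : R :=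
  inf [set vnorm (M *m x) | x in [set x : 'cV[R]_n | vnorm x = 1]].

Definition cond (m n : nat) (M : 'M[R]_(m, n)) : R := sigma_max M / sigma_min M.

Definition is_reduced_QR (l n : nat) (A1 Q : 'M[R]_(l, n)) (R1 : 'M[R]_n) : Prop :=
  [/\ Q^T *m Q = 1%:M, A1 = Q *m R1,
      (forall i j : 'I_n, (j < i)%N -> R1 i j = 0) &
      (forall i : 'I_n, 0 < R1 i i)].

(* The (unique, when A1 has full column rank) R factor, chosen classically. *)
Definition qrR (l n : nat) (A1 : 'M[R]_(l, n)) : 'M[R]_n :=
  xget 0 [set R1 | exists Q, is_reduced_QR A1 Q R1].

Definition condX (l m n : nat) (A : 'M[R]_(m, n)) (Om : 'M[R]_(l, m)) : \bar R :=
  let A1 := Om *m A in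
  if \rank A1 == n then (cond (A *m invmx (qrR A1)))%:E else +oo%E.

Definition gaussian_matrix d (T : measurableType d) (P : probability T R)
    (l m : nat) (Om : T -> 'M[R]_(l, m)) : Prop :=
  [/\ (forall i j, measurable_fun setT (fun w => Om w i j)),
      (forall i j (B : set R), measurable B ->
          P ((fun w => Om w i j) @^-1` B) = normal_prob 0 1 B) &
      (forall B : 'I_l -> 'I_m -> set R, (forall i j, measurable (B i j)) ->
          P [set w | forall i j, B i j (Om w i j)] =
          (\prod_i \prod_j P ((fun w => Om w i j) @^-1` B i j))%E)].

End Defs.

(* Main.v *)
(** Write A = Q U with Q orthonormal; then cond(X) is governed by the extreme
    values of |G v| / |v| for the Gaussian matrix G = Om Q, and for
    a = sqrt l, b = sqrt n the threshold is (3 a + b) / (a - b).  Put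
    d = (a - b) / (a + b), s = 2 exp(-1 - d/4) (a - b) and
    S = 99/100 * 2 exp(-1 - d/4) (3 a + b): it suffices that
    s |v| <= |G v| <= S |v| for all v, except on two events of probability at
    most exp(-(a - b)^2 / 8) each.

    Both events are controlled by Markov's inequality for a moment of high
    order, and the supremum over v is replaced by an average over an
    independent copy Om' of Om.  For a unit vector x and eta = Om' x, the
    average of |G^T eta|^(2q) over Om' is at least
    (2q-1)!! |G v|^(2q) / |v|^(2q) for every v, while its expectation is the
    product of the (l + 2j)(n + 2j), j < q.  For a unit vector u and
    xi = (Om' Q)^T u, Cauchy-Schwarz for the form G^T G + e bounds the average
    of (xi^T (G^T G + e)^-1 xi)^p from below by
    (2p-1)!! |v|^(2p) / (|G v|^2 + e |v|^2)^p, while its expectation is at most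
    the product of the (n + 2j) / (l - n - 1 - 2j), j < p.  All expectations
    come from Gaussian integration by parts.  The case a - b < 2 is trivial
    because the bound then exceeds 1. *)
Require Import Defs.
From HB Require Import structures.
From mathcomp Require Import all_boot all_order all_algebra.
From mathcomp Require Import all_classical all_reals all_analysis.
From mathcomp Require Import normal_distribution measurable_realfun.
From mathcomp Require Import ring lra zify.
Import Order.TTheory GRing.Theory Num.Theory.
Import numFieldNormedType.Exports.
Local Open Scope classical_set_scope.
Local Open Scope ring_scope.
Set Implicit Arguments. Unset Strict Implicit. Unset Printing Implicit Defensive.

(** A supremum over [v] has no accessible moments. Averaging a quadratic form over a Gaussian vector
    avoids it: Cauchy-Schwarz bounds the average from below for every [v], and Tonelli lets the
    matrix be integrated with the vector frozen. The vector comes from [Om] itself, as a second copy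
    applied to a fixed unit vector.

    On the lower side the obstacle is that the inverse Gram matrix may not exist and is unbounded,
    so nothing is integrable a priori. The shift e > 0 bounds it by 1/e, and no limit e -> 0 is
    taken: an explicit [e] fits into the slack of the product estimates.

    The factor 2 exp(-1 - d/4) is dictated by the lower tail. With k = l - n = (a - b)(a + b) and p
    about k/4, Stirling asks for (n + k/4) s^2 <= k^2 exp(-2 - d/2), and 4n + k = a^2 + 3b^2 <= (a +
    b)^2. The gain exp(-d/2), taken p >= k/4 times, is at most exp(-(a - b)^2/8). The upper tail has
    room to spare; the factor 99/100 spends some of it on making S / s < (3a + b)/(a - b) strict. *)

(** * Euclidean norm and reduced QR decomposition *)

Section euclidean_norm.
Context {R : realType}.

Lemma vnorm_ge0 n (v : 'cV[R]_n) : 0 <= vnorm v.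
Proof. exact: sqrtr_ge0. Qed.

Lemma sqr_vnorm n (v : 'cV[R]_n) : vnorm v ^+ 2 = \sum_i v i 0 ^+ 2.
Proof. by rewrite sqr_sqrtr// sumr_ge0// => i _; exact: sqr_ge0. Qed.

Lemma sqr_vnormE n (v : 'cV[R]_n) : vnorm v ^+ 2 = (v^T *m v) 0 0.
Proof. by rewrite sqr_vnorm mxE; apply: eq_bigr => i _; rewrite mxE. Qed.

Lemma vnorm0_eq0 n (v : 'cV[R]_n) : vnorm v = 0 -> v = 0.
Proof.
move=> v0; have := sqr_vnorm v; rewrite v0 expr0n /= => /esym/eqP.
rewrite psumr_eq0 => [/allP v_eq0|i _]; last exact: sqr_ge0.
apply/colP => i; rewrite mxE; apply/eqP.
by have := v_eq0 i; rewrite mem_index_enum => /(_ isT); rewrite /= sqrf_eq0.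
Qed.

Lemma vnorm_gt0 n (v : 'cV[R]_n) : v != 0 -> 0 < vnorm v.
Proof.
move=> v0; rewrite lt_neqAle vnorm_ge0 andbT eq_sym.
by apply: contra_neq v0 => /vnorm0_eq0.
Qed.

Lemma vnormZ n a (v : 'cV[R]_n) : vnorm (a *: v) = `|a| * vnorm v.
Proof.
rewrite /vnorm -sqrtr_sqr -sqrtrM ?sqr_ge0//; congr Num.sqrt.
by rewrite mulr_sumr; apply: eq_bigr => i _; rewrite mxE exprMn.
Qed.

Lemma vnorm0 n : vnorm (0 : 'cV[R]_n) = 0.
Proof. by rewrite -(scale0r (0 : 'cV[R]_n)) vnormZ normr0 mul0r. Qed.

Lemma vnorm_isometry l n (Q : 'M[R]_(l, n)) (v : 'cV[R]_n) :
  Q^T *m Q = 1%:M -> vnorm (Q *m v) = vnorm v.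
Proof.
move=> QQ; apply/eqP; rewrite -(@eqrXn2 _ 2) ?vnorm_ge0//; apply/eqP.
by rewrite !sqr_vnormE trmx_mul mulmxA -(mulmxA v^T) QQ mulmx1.
Qed.

Lemma cauchy_schwarz n (u v : 'cV[R]_n) :
  ((u^T *m v) 0 0) ^+ 2 <= vnorm u ^+ 2 * vnorm v ^+ 2.
Proof.
have [->|/vnorm_gt0 u0] := eqVneq u 0.
  by rewrite trmx0 mul0mx mxE expr0n/= mulr_ge0 ?sqr_ge0.
pose c := (u^T *m v) 0 0; pose r := vnorm u ^+ 2.
have r0 : 0 < r by rewrite exprn_gt0.
(* The residual of projecting [v] onto [u], scaled by |u|^2 to stay free of division. *)
have : 0 <= \sum_i (r * v i 0 - c * u i 0) ^+ 2.
  by rewrite sumr_ge0// => i _; exact: sqr_ge0.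
have -> : \sum_i (r * v i 0 - c * u i 0) ^+ 2 = r * (r * vnorm v ^+ 2 - c ^+ 2).
  under eq_bigr do rewrite sqrrB !exprMn.
  rewrite big_split sumrB /= -!mulr_sumr -!sqr_vnorm -/r.
  have -> : \sum_i r * v i 0 * (c * u i 0) *+ 2 = r * c * c *+ 2.
    rewrite sumrMnl; congr (_ *+ 2).
    have cE : c = \sum_i u i 0 * v i 0.
      by rewrite /c mxE; apply: eq_bigr => i _; rewrite mxE.
    rewrite [X in _ = _ * X]cE mulr_sumr; apply: eq_bigr => i _; ring.
  ring.
rewrite pmulr_rge0// subr_ge0.
by rewrite /c /r.
Qed.

(** The Frobenius norm serves as [K], by Cauchy-Schwarz on each row. This bounds the set under the
    [sup] of [sigma_max], which would otherwise take a default value. *)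
Lemma vnorm_mulmx_le m n (M : 'M[R]_(m, n)) :
  exists2 K, 0 <= K & forall v, vnorm (M *m v) <= K * vnorm v.
Proof.
pose K2 := \sum_i vnorm (row i M)^T ^+ 2.
have K20 : 0 <= K2 by apply: sumr_ge0 => i _; exact: sqr_ge0.
exists (Num.sqrt K2) => [|v]; first exact: sqrtr_ge0.
rewrite -(@ler_pXn2r _ 2) ?nnegrE ?mulr_ge0 ?vnorm_ge0 ?sqrtr_ge0//.
rewrite exprMn [_ (M *m v) ^+ 2]sqr_vnorm sqr_sqrtr// mulr_suml; apply: ler_sum => i _.
have -> : (M *m v) i 0 = ((row i M)^T^T *m v) 0 0 by rewrite trmxK -row_mul [RHS]mxE.
exact: cauchy_schwarz.
Qed.

End euclidean_norm.

Section qr.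
Context {R : realType}.

Lemma rank_injP m n (M : 'M[R]_(m, n)) :
  \rank M = n <-> forall x : 'cV[R]_n, M *m x = 0 -> x = 0.
Proof.
split=> [rM x Mx|inj].
  have /mulmx_free_eq0 fr : row_free M^T by rewrite /row_free mxrank_tr rM.
  apply: trmx_inj; apply/eqP; rewrite trmx0 -(fr _ x^T) -trmx_mul Mx.
  by rewrite trmx0.
apply/eqP; rewrite -mxrank_tr; apply: inj_row_free => v vM.
by apply: trmx_inj; rewrite trmx0; apply: inj; rewrite -[M]trmxK -trmx_mul vM trmx0.
Qed.

Lemma inj_unitmx n (M : 'M[R]_n) :
  (forall x : 'cV[R]_n, M *m x = 0 -> x = 0) -> M \in unitmx.
Proof. by move/rank_injP => rM; rewrite -row_free_unit /row_free rM. Qed.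

(** Gram-Schmidt by induction on the number of columns: normalize the first column, remove its
    component from the others, recurse on the remainder [B']. *)
Lemma reduced_QR_exists l n (A : 'M[R]_(l, n)) : \rank A = n ->
  exists Q T, is_reduced_QR A Q T.
Proof.
move/rank_injP; elim: n A => [|n IH] A injA.
  exists 0, 0; split; try by case.
  - by apply/matrixP => -[].
  - by apply/matrixP => i [].
change ('M[R]_(l, 1 + n)) in (type of A).
pose a := lsubmx A; pose B := rsubmx A.
have AE : A = row_mx a B by rewrite hsubmxK.
have a0 : a != 0.
  apply/eqP => a0.
  have /injA : A *m col_mx (1%:M : 'M[R]_1) (0 : 'cV[R]_n) = 0.
    by rewrite AE mul_row_col a0 mul0mx mulmx0 addr0.
  move/(congr1 (fun v : 'cV[R]_(1 + n) => v (lshift n 0) 0)).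
  by rewrite col_mxEu !mxE eqxx => /eqP; rewrite oner_eq0.
have na := vnorm_gt0 a0; set r11 := vnorm a in na.
pose q := r11^-1 *: a.
have qq : q^T *m q = 1%:M.
  apply/matrixP => i j; rewrite !ord1 -sqr_vnormE vnormZ !mxE.
  by rewrite gtr0_norm ?invr_gt0// mulVf ?(gt_eqF na)// expr1n eqxx.
have aE : a = r11 *: q by rewrite scalerA divff ?gt_eqF// scale1r.
pose r := q^T *m B; pose B' := B - q *m r.
have qB' : q^T *m B' = 0 by rewrite mulmxBr mulmxA qq mul1mx subrr.
(* A kernel vector of [B'] extends to one of [A]: its first coordinate compensates the removed
   component [q *m r *m x]. *)
have injB' : forall x : 'cV[R]_n, B' *m x = 0 -> x = 0.
  move=> x; rewrite mulmxBl => /subr0_eq Bx.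
  have /injA : A *m col_mx (- r11^-1 *: (r *m x)) x = 0.
    rewrite AE mul_row_col Bx -!mulmxA aE -scalemxAl -scalemxAr scalerA.
    by rewrite mulrN divff ?(gt_eqF na)// scaleN1r addNr.
  by move/(congr1 (@dsubmx R 1 n 1)); rewrite col_mxKd => ->; apply/colP => i; rewrite !mxE.
have [Q' [T' [QQ BE up pos]]] := IH B' injB'.
have T'u : T' \in unitmx.
  by apply: inj_unitmx => x T'x; apply: injB'; rewrite BE -mulmxA T'x mulmx0.
have qQ : q^T *m Q' = 0.
  by rewrite -[Q'](mulmxK T'u) -BE mulmxA qB' mul0mx.
pose Q : 'M[R]_(l, 1 + n) := row_mx q Q'.
pose T : 'M[R]_(1 + n) := block_mx (r11%:M : 'M[R]_1) r 0 T'.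
have orthQ : Q^T *m Q = 1%:M.
  rewrite /Q tr_row_mx mul_col_row qq qQ QQ scalar_mx_block.
  by rewrite -[Q'^T *m q]trmxK trmx_mul trmxK qQ trmx0.
have AQT : A = Q *m T.
  rewrite /Q /T mul_row_block mulmx0 addr0 mul_mx_scalar -aE AE; congr row_mx.
  by rewrite -BE addrC subrK.
have upT (i j : 'I_(1 + n)) : (j < i)%N -> T i j = 0.
  rewrite /T; case: (split_ordP i) => i' ->; case: (split_ordP j) => j' ->.
  + by rewrite !ord1.
  + by rewrite ord1.
  + by rewrite block_mxEdl mxE.
  + by rewrite block_mxEdr /= => /up.
have posT (i : 'I_(1 + n)) : 0 < T i i.
  rewrite /T; case: (split_ordP i) => i' ->.
  + by rewrite block_mxEul ord1 mxE eqxx mulr1n.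
  + by rewrite block_mxEdr.
by exists Q, T.
Qed.

End qr.

(** * The condition number as a division-free inequality *)

Section condition_number.
Context {R : realType}.

(** A left inverse of [M] is bounded, so compactness of the sphere is bypassed. Its bound [K] may be
    0, hence [K + 1]. *)
Lemma full_rank_vnorm_ge m n (M : 'M[R]_(m, n)) : \rank M = n ->
  exists2 e, 0 < e & forall v, e * vnorm v <= vnorm (M *m v).
Proof.
move=> rM; have /row_freeP[B MB] : row_free M^T by rewrite /row_free mxrank_tr rM.
have BM : B^T *m M = 1%:M by rewrite -[M]trmxK -trmx_mul MB trmx1.
have [K K0 HK] := vnorm_mulmx_le B^T.
have K1 : 0 < K + 1 by rewrite ltr_wpDl.
exists (K + 1)^-1; first by rewrite invr_gt0.
move=> v; rewrite ler_pdivrMl//.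
have := HK (M *m v); rewrite mulmxA BM mul1mx => /le_trans; apply.
by rewrite ler_wpM2r ?vnorm_ge0// lerDl.
Qed.

Lemma delta_vnorm n (i : 'I_n) : vnorm (delta_mx i 0 : 'cV[R]_n) = 1.
Proof.
rewrite /vnorm (bigD1 i)//= big1 => [|j ji]; last first.
  by rewrite mxE (negbTE ji) expr0n.
by rewrite mxE !eqxx expr1n addr0 sqrtr1.
Qed.

Variables (l m n : nat).
Implicit Types (A : 'M[R]_(m, n)) (Om : 'M[R]_(l, m)).

(* Division-free, hence valid also when [Om *m A] is rank deficient; the rational
   bound makes the event a countable union of countable intersections. *)
Lemma condX_lt A Om (c : R) : (0 < n)%N -> \rank A = n ->
  (condX A Om < c%:E)%E <->
  Om *m A != 0 /\ exists2 r : rat, ratr r < c & forall u v : 'cV[R]_n,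
    vnorm (A *m u) * vnorm (Om *m A *m v) <=
    ratr r * (vnorm (Om *m A *m u) * vnorm (A *m v)).
Proof.
move=> n0 rA; set A1 := Om *m A.
(* Only norms are kept: at t = T u the quotient |X t| / |t| equals |A u| / |A1 u|, so the orthogonal
   factor drops out. Existence of a QR decomposition keeps [xget] off its default 0. *)
have qr : \rank A1 = n -> exists T, [/\ condX A Om = (cond (A *m invmx T))%:E,
    T \in unitmx & forall u, vnorm (A1 *m u) = vnorm (T *m u)].
  move=> rA1; exists (qrR A1).
  have [Q [QQ AE up pos]] : exists Q, is_reduced_QR A1 Q (qrR A1).
    have [Q [T QT]] := reduced_QR_exists rA1.
    by apply: (@xgetPex _ 0 [set T | exists Q, is_reduced_QR A1 Q T]); exists T, Q.
  split; first by rewrite /condX -/A1 rA1 eqxx.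
    apply: inj_unitmx => x Tx; apply: (rank_injP A1).1 => //.
    by rewrite AE -mulmxA Tx mulmx0.
  by move=> u; rewrite {1}AE -mulmxA vnorm_isometry.
pose e0 : 'cV[R]_n := delta_mx (Ordinal n0) 0.
have e01 : vnorm e0 = 1 by exact: delta_vnorm.
have e00 : e0 != 0.
  by apply/eqP => e00; move: e01; rewrite e00 vnorm0 => /esym/eqP; rewrite oner_eq0.
have rX T : T \in unitmx -> \rank (A *m invmx T) = n.
  by move=> uT; rewrite mxrankMfree// row_free_unit unitmx_inv.
have inf_gt0 T : T \in unitmx -> 0 < sigma_min (A *m invmx T).
  move=> uT; have [e e_gt0 He] := full_rank_vnorm_ge (rX _ uT).
  apply: lt_le_trans e_gt0 _; apply: lb_le_inf; first by exists (vnorm (A *m invmx T *m e0)), e0.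
  by move=> _ [x /= x1 <-]; rewrite -[leLHS]mulr1 -x1.
split=> [cX|[A10 [r rc Hr]]].
  have rA1 : \rank A1 = n.
    by move: cX; rewrite /condX -/A1; case: eqP => // _; rewrite ltNge leey.
  split.
    apply/eqP => A10; have /negP := e00; apply; apply/eqP.
    by apply: (rank_injP A1).1 => //; rewrite A10 mul0mx.
  have [T [cE uT A1T]] := qr rA1.
  move: cX; rewrite cE lte_fin => /rat_in_itvoo[r]; rewrite in_itv /= => /andP[cr rc].
  exists r => // u v; set X := A *m invmx T in cr *.
  have smin0 := inf_gt0 _ uT; rewrite -/X in smin0.
  have AX w : A *m w = X *m (T *m w) by rewrite /X -!mulmxA mulKmx.
  have scale (w : 'cV[R]_n) : exists2 x, vnorm x = 1 & w = vnorm w *: x.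
    have [->|/vnorm_gt0 w0] := eqVneq w 0; first by exists e0; rewrite // vnorm0 scale0r.
    exists ((vnorm w)^-1 *: w); last by rewrite scalerA divff ?scale1r// gt_eqF.
    by rewrite vnormZ gtr0_norm ?invr_gt0// mulVf// gt_eqF.
  have up (w : 'cV[R]_n) : vnorm (X *m w) <= sigma_max X * vnorm w.
    have [x x1 ->] := scale w; rewrite -scalemxAr !vnormZ x1 mulr1 mulrC.
    rewrite ler_wpM2r//; apply: ub_le_sup; last by exists x.
    have [K K0 HK] := vnorm_mulmx_le X.
    by exists K => _ [z /= z1 <-]; rewrite -[leRHS]mulr1 -z1.
  have lo (w : 'cV[R]_n) : sigma_min X * vnorm w <= vnorm (X *m w).
    have [x x1 ->] := scale w; rewrite -scalemxAr !vnormZ x1 mulr1 [leRHS]mulrC.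
    rewrite ler_wpM2r//; apply: ge_inf; last by exists x.
    by exists 0 => _ [z /= z1 <-]; exact: vnorm_ge0.
  have mm : sigma_max X <= ratr r * sigma_min X by rewrite -ler_pdivrMr// ltW.
  rewrite !A1T !AX; set tu := T *m u; set tv := T *m v.
  have t1 : vnorm (X *m tu) * vnorm tv <= sigma_max X * vnorm tu * vnorm tv.
    by rewrite ler_wpM2r ?vnorm_ge0.
  apply: le_trans t1 _.
  have r0 : 0 <= ratr r :> R.
    rewrite -(@pmulr_lge0 _ (sigma_min X))//; apply: le_trans mm.
    by have := up e0; rewrite e01 mulr1; apply: le_trans; exact: vnorm_ge0.
  apply: (@le_trans _ _ (ratr r * sigma_min X * vnorm tu * vnorm tv)).
    rewrite -(mulrA (sigma_max X)) -(mulrA (_ * sigma_min X)).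
    by apply: ler_wpM2r mm; rewrite mulr_ge0 ?vnorm_ge0.
  have := ler_wpM2l (mulr_ge0 r0 (vnorm_ge0 tu)) (lo tv); lra.
(* A kernel vector [x] of [A1], tested against some [v] with [A1 *m v != 0], turns the inequality
   into |A x| |A1 v| <= 0, whence x = 0. This is the role of the condition [Om *m A != 0]. *)
have rA1 : \rank A1 = n.
  apply/rank_injP => x A1x; apply: (rank_injP A).1 => //; apply: vnorm0_eq0.
  have [v A1v] : exists v : 'cV[R]_n, A1 *m v != 0.
    apply: contrapT => /forallNP h; case/negP: A10; apply/eqP/matrixP => i j.
    have /negP := h (delta_mx j 0); rewrite negbK -colE => /eqP/colP/(_ i).
    by rewrite !mxE.
  have := Hr x v; rewrite A1x vnorm0 mul0r mulr0 pmulr_lle0 ?vnorm_gt0// => h.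
  by apply/eqP; rewrite eq_le h vnorm_ge0.
have [T [-> uT A1T]] := qr rA1.
rewrite lte_fin; apply: le_lt_trans rc; set X := A *m invmx T.
have smin0 := inf_gt0 _ uT; rewrite -/X in smin0.
rewrite ler_pdivrMr//; apply: ge_sup; first by exists (vnorm (X *m e0)), e0.
move=> _ [x /= x1 <-].
(* The inequality at [u = invmx T *m x] and [v = invmx T *m y] compares the values of [X] at two
   arbitrary unit vectors. *)
have hx y : vnorm y = 1 -> vnorm (X *m x) <= ratr r * vnorm (X *m y).
  move=> y1; have := Hr (invmx T *m x) (invmx T *m y).
  by rewrite !A1T !mulKVmx// x1 y1 mulr1 mul1r !mulmxA.
have r0 : 0 < ratr r :> R.
  have [e e_gt0 He] := full_rank_vnorm_ge (rX _ uT).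
  have Xx : 0 < vnorm (X *m x).
    by apply: lt_le_trans (He x); rewrite x1 mulr1.
  by have := lt_le_trans Xx (hx _ x1); rewrite pmulr_lgt0.
rewrite mulrC -ler_pdivrMr//; apply: lb_le_inf; first by exists (vnorm (X *m e0)), e0.
by move=> _ [y /= y1 <-]; rewrite ler_pdivrMr// mulrC; exact: hx.
Qed.

End condition_number.

(** * Measurability of the event *)

Section rational_density.
Context {R : realType}.

Lemma cvg_bigsum (T : Type) (F : set_system T) (FF : Filter F) (I : Type)
    (s : seq I) (f : I -> T -> R) (y : I -> R) :
  (forall i, f i x @[x --> F] --> y i) ->
  \sum_(i <- s) f i x @[x --> F] --> \sum_(i <- s) y i.
Proof.
move=> fy; elim: s => [|i s IH].
  under eq_fun do rewrite big_nil.
  by rewrite big_nil; exact: cvg_cst.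
under eq_fun do rewrite big_cons.
by rewrite big_cons; apply: cvgD.
Qed.

Lemma cvg_vnorm_mulmx m n (M : 'M[R]_(m, n)) (u : nat -> 'cV[R]_n) (v : 'cV[R]_n) :
  (forall i, u k i 0 @[k --> \oo] --> v i 0) ->
  vnorm (M *m u k) @[k --> \oo] --> vnorm (M *m v).
Proof.
move=> uv.
have h : \sum_i (M *m u k) i 0 ^+ 2 @[k --> \oo] --> \sum_i (M *m v) i 0 ^+ 2.
  apply: cvg_bigsum => i; under eq_fun do rewrite expr2 mxE.
  rewrite expr2 mxE.
  by apply: cvgM; apply: cvg_bigsum => j; apply: cvgM => //; exact: cvg_cst.
exact: (cvg_comp _ _ h (@sqrt_continuous R _)).
Qed.

Lemma rat_vector_approx n (v : 'cV[R]_n) : exists u : nat -> 'cV[rat]_n,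
  forall i, (map_mx ratr (u k)) i 0 @[k --> \oo] --> v i 0.
Proof.
have /choice[q hq] : forall ki : nat * 'I_n, exists q : rat,
    ratr q \in `]v ki.2 0, v ki.2 0 + ki.1.+1%:R^-1[.
  by move=> ki; apply: rat_in_itvoo; rewrite ltrDl invr_gt0.
exists (fun k => \col_i q (k, i)) => i.
apply: (@squeeze_cvgr _ _ _ _ (fun=> v i 0) (fun k => v i 0 + k.+1%:R^-1)).
- apply: nearW => k; have := hq (k, i); rewrite in_itv /= => /andP[h1 h2].
  by rewrite !mxE !ltW.
- exact: cvg_cst.
- rewrite -[X in _ --> X]addr0; apply: cvgD; first exact: cvg_cst.
  exact: cvg_harmonic.
Qed.

(** Both sides are continuous in [u] and [v], and a non-strict inequality passes to the limit. Only
    countably many conditions on [B] remain. *)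
Lemma rat_vectors_suffice l m n (A : 'M[R]_(m, n)) (B : 'M[R]_(l, n)) (c : R) :
  (forall u v : 'cV[rat]_n,
    vnorm (A *m map_mx ratr u) * vnorm (B *m map_mx ratr v) <=
    c * (vnorm (B *m map_mx ratr u) * vnorm (A *m map_mx ratr v))) ->
  forall u v : 'cV[R]_n,
    vnorm (A *m u) * vnorm (B *m v) <= c * (vnorm (B *m u) * vnorm (A *m v)).
Proof.
move=> H u v; have [u' hu] := rat_vector_approx u; have [v' hv] := rat_vector_approx v.
have h1 := cvgM (@cvg_vnorm_mulmx _ _ A _ _ hu) (@cvg_vnorm_mulmx _ _ B _ _ hv).
have h2 := cvgM (cvg_cst c) (cvgM (@cvg_vnorm_mulmx _ _ B _ _ hu) (@cvg_vnorm_mulmx _ _ A _ _ hv)).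
apply: (ler_cvg_to (h1 _) (h2 _ _ _)).
by apply: nearW => k; exact: H.
Qed.

End rational_density.

Section measurable_matrix_functions.
Context {R : realType} d (T : measurableType d).

Definition measurable_mx m n (M : T -> 'M[R]_(m, n)) :=
  forall i j, measurable_fun setT (fun w => M w i j).

Lemma measurable_mx_cst m n (M : 'M[R]_(m, n)) : measurable_mx (fun=> M).
Proof. by move=> i j; exact: measurable_cst. Qed.

Lemma measurable_mulmx m n p (M : T -> 'M[R]_(m, n)) (N : T -> 'M[R]_(n, p)) :
  measurable_mx M -> measurable_mx N -> measurable_mx (fun w => M w *m N w).
Proof.
move=> mM mN i j; under eq_fun do rewrite mxE.
by apply: measurable_sum => k; exact: measurable_funM.
Qed.

Lemma measurable_trmx m n (M : T -> 'M[R]_(m, n)) :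
  measurable_mx M -> measurable_mx (fun w => (M w)^T).
Proof. by move=> mM i j; under eq_fun do rewrite mxE; exact: mM. Qed.

Lemma measurable_vnorm n (v : T -> 'cV[R]_n) :
  measurable_mx v -> measurable_fun setT (fun w => vnorm (v w)).
Proof.
move=> mv; apply: (measurableT_comp (continuous_measurable_fun (@sqrt_continuous R))).
by apply: measurable_sum => i; exact: measurable_funX.
Qed.

Lemma countable_forall_measurable (I : countType) (F : I -> set T) :
  (forall i, measurable (F i)) -> measurable [set w | forall i, F i w].
Proof.
move=> mF; rewrite (_ : mkset _ = ~` (\bigcup_i ~` F i)); last first.
  rewrite setC_bigcup; apply/seteqP; split => w h i => [_|].
    by rewrite /= notE; exact: h.
  by have := h i Logic.I; rewrite /= notE.
apply: measurableC; apply: countable_bigcupT_measurable => [|i]; first exact: countableP.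
exact: measurableC.
Qed.

(** [qrR] is a classical choice, so its definition says nothing about measurability. The complement
    of the event is rewritten by [condX_lt] with rational vectors: [Om *m A] is nonzero and some
    rational below [c] works. *)
Lemma measurable_condX_ge l m n (A : 'M[R]_(m, n)) (Om : T -> 'M[R]_(l, m)) (c : R) :
  (0 < n)%N -> \rank A = n -> measurable_mx Om ->
  measurable [set w | (c%:E <= condX A (Om w))%E].
Proof.
move=> n0 rA mOm.
have mB : measurable_mx (fun w => Om w *m A).
  by apply: measurable_mulmx => //; exact: measurable_mx_cst.
pose Z : set T := [set w | forall ij : 'I_l * 'I_n, (Om w *m A) ij.1 ij.2 = 0].
pose D (r : rat) : set T := if ratr r < c then
  [set w | forall uv : 'cV[rat]_n * 'cV[rat]_n,
    vnorm (A *m map_mx ratr uv.1) * vnorm (Om w *m A *m map_mx ratr uv.2) <=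
    ratr r * (vnorm (Om w *m A *m map_mx ratr uv.1) * vnorm (A *m map_mx ratr uv.2))]
  else set0.
have -> : [set w | (c%:E <= condX A (Om w))%E] = ~` (~` Z `&` \bigcup_r D r).
  apply/seteqP; split => w /=.
    rewrite leNgt => /negP h [Zw [r _]]; rewrite /D; case: ifPn => // rc Hr.
    apply: h; apply/(condX_lt _ _ n0 rA); split.
      by apply/eqP => B0; apply: Zw => ij; rewrite B0 mxE.
    by exists r => //; apply: rat_vectors_suffice => u v; exact: (Hr (u, v)).
  move=> h; rewrite leNgt; apply/negP => /(condX_lt _ _ n0 rA)[B0 [r rc Hr]].
  apply: h; split.
    by move=> Zw; move/eqP: B0; apply; apply/matrixP => i j; rewrite (Zw (i, j)) mxE.
  by exists r => //; rewrite /D rc => uv; exact: Hr.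
have mnorm k (M : T -> 'M[R]_(k, n)) (u : 'cV[rat]_n) : measurable_mx M ->
    measurable_fun setT (fun w => vnorm (M w *m map_mx ratr u)).
  by move=> mM; apply: measurable_vnorm; apply: measurable_mulmx.
apply: measurableC; apply: measurableI.
  apply: measurableC; apply: countable_forall_measurable => ij.
  rewrite -[X in measurable X]setTI.
  exact: (mB ij.1 ij.2 measurableT [set 0] (measurable_set1 _)).
apply: bigcupT_measurable_rat => r; rewrite /D; case: ifP => // _.
apply: countable_forall_measurable => uv.
rewrite -[X in measurable X]setTI; apply: measurable_fun_le => //.
  by apply: measurable_funM; apply: mnorm => //; exact: measurable_mx_cst.
apply: measurable_funM => //.
by apply: measurable_funM; apply: mnorm => //; exact: measurable_mx_cst.
Qed.

End measurable_matrix_functions.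

(** * Integration by parts for one normal variable *)

Section gauss1.
Context {R : realType}.
Local Notation mu := (@lebesgue_measure R).
Local Notation gamma := (normal_prob (0 : R) 1).
Local Notation phi := (normal_pdf (0 : R) 1).

(** Integrals against the normal law unfold to a Radon-Nikodym derivative; identifying it with the
    density makes them Lebesgue integrals. *)
Lemma normal_prob_pdf_ae (m s : R) :
  ae_eq mu setT (Radon_Nikodym_SigmaFinite.f (normal_prob m s) mu)
    (EFin \o normal_pdf m s).
Proof.
have dom := @normal_prob_dominates R m s.
apply: integral_ae_eq => //.
- exact: Radon_Nikodym_SigmaFinite.f_integrable.
- by apply/measurable_EFinP; exact: measurable_normal_pdf.
- by move=> E _ mE; rewrite -Radon_Nikodym_SigmaFinite.f_integral.
Qed.

Lemma ge0_integral_normal_prob (m s : R) (f : R -> \bar R) :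
  (forall x, 0 <= f x)%E -> measurable_fun setT f ->
  (\int[normal_prob m s]_x f x = \int[mu]_x (f x * (normal_pdf m s x)%:E))%E.
Proof.
move=> f0 mf; have dom := @normal_prob_dominates R m s.
rewrite -(Radon_Nikodym_SigmaFinite.change_of_variables dom)//.
apply: ae_eq_integral => //.
- apply: emeasurable_funM => //; apply: measurable_int.
  exact: Radon_Nikodym_SigmaFinite.f_integrable.
- apply: emeasurable_funM => //; apply/measurable_EFinP; exact: measurable_normal_pdf.
- by apply: ae_eqe_mul2l; exact: normal_prob_pdf_ae.
Qed.

Lemma integral_normal_prob (m s : R) (f : R -> \bar R) :
  (normal_prob m s).-integrable setT f ->
  (\int[normal_prob m s]_x f x = \int[mu]_x (f x * (normal_pdf m s x)%:E))%E.
Proof.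
move=> intf; have mf := measurable_int _ intf.
have dom := @normal_prob_dominates R m s.
rewrite -(Radon_Nikodym_change_of_variables dom)//.
apply: ae_eq_integral => //.
- by apply: emeasurable_funM => //.
- apply: emeasurable_funM => //; apply/measurable_EFinP; exact: measurable_normal_pdf.
- apply: ae_eqe_mul2l; apply: ae_eq_trans (normal_prob_pdf_ae m s).
  by apply: ae_eq_sym; exact: ae_eq_Radon_Nikodym_SigmaFinite.
Qed.

Lemma pdf01E x : phi x = normal_peak 1 * expR (- (x ^+ 2 / 2)).
Proof.
by rewrite normal_pdfE ?oner_eq0// /normal_fun subr0 expr1n mulNr.
Qed.

Lemma is_derive_pdf01 x : is_derive x (1 : R) phi (- x * phi x).
Proof.
rewrite (_ : normal_pdf _ _ = fun x => normal_peak 1 * expR (- (x ^+ 2 / 2))); last first.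
  by apply/funext => y; exact: pdf01E.
have d1 : is_derive x (1 : R) (fun x : R => - (x ^+ 2 / 2)) (- x).
  apply: is_derive_eq. rewrite /GRing.scale /=. by field.
have d2 := @is_derive1_comp R (@expR R) _ x _ _ (is_derive_expR _) d1.
apply: is_derive_eq. rewrite /GRing.scale /=. ring.
Qed.

(** A wider normal density absorbs any polynomial: (1 + |x|)^r <= r! exp(1 + |x|) by one term of the
    series, and 1 + |x| - x^2/2 <= 3 - x^2/8 by completing the square at |x| = 4/3. The wider
    density is integrable and tends to 0, which serves both domination and boundary terms. *)
Lemma poly_pdf01_le (r : nat) : exists2 C : R, 0 <= C &
  forall x, (1 + `|x|) ^+ r * phi x <= C * normal_pdf 0 2 x.
Proof.
have p2 : 0 < normal_peak 2 :> R by exact: normal_peak_gt0.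
have p1 : 0 < normal_peak 1 :> R by exact: normal_peak_gt0.
exists (r`!%:R * expR 3 * normal_peak 1 / normal_peak 2) => [|x].
  by rewrite divr_ge0 ?mulr_ge0 ?expR_ge0// ltW.
rewrite pdf01E normal_pdfE// /normal_fun subr0.
have -> : - x ^+ 2 / (2 ^+ 2 *+ 2) = - (x ^+ 2 / 8) :> R by rewrite -mulr_natr; field.
rewrite [leRHS]mulrA divfK ?(gt_eqF p2)//.
have h1 : (1 + `|x|) ^+ r <= r`!%:R * expR (1 + `|x|).
  case: r => [|r]; first by rewrite expr0 fact0 mul1r -expR0 ler_expR addr_ge0.
  rewrite -ler_pdivrMl ?ltr0n ?fact_gt0// mulrC.
  by apply: le_trans (@expR_ge1Dxn _ _ r _); rewrite ?lerDr ?addr_ge0.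
have h2 : expR (1 + `|x|) * expR (- (x ^+ 2 / 2)) <= expR 3 * expR (- (x ^+ 2 / 8)).
  rewrite -!expRD ler_expR -real_normK ?num_real//.
  have := sqr_ge0 (`|x| - 4 / 3); have := normr_ge0 x; nra.
have e0 := expR_ge0 (- (x ^+ 2 / 2)).
have := ler_wpM2r e0 h1; rewrite -[leRHS]mulrA => h3.
have f0 : 0 <= r`!%:R :> R by [].
have h4 := le_trans h3 (ler_wpM2l f0 h2).
have := ler_wpM2l (ltW p1) h4.
lra.
Qed.

Definition poly_growth (f : R -> R) := exists2 Cr : R * nat, 0 <= Cr.1 &
  forall x, `|f x| <= Cr.1 * (1 + `|x|) ^+ Cr.2.

Lemma poly_growthM f g : poly_growth f -> poly_growth g -> poly_growth (f \* g).
Proof.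
move=> [[C r] /= C0 Hf] [[D q] /= D0 Hg]; exists (C * D, (r + q)%N) => /=.
  exact: mulr_ge0.
move=> x; rewrite normrM exprD mulrACA.
by apply: ler_pM => //; rewrite mulr_ge0.
Qed.

Lemma poly_growthB f g : poly_growth f -> poly_growth g -> poly_growth (f \- g).
Proof.
move=> [[C r] /= C0 Hf] [[D q] /= D0 Hg]; exists (C + D, maxn r q) => /=.
  exact: addr_ge0.
move=> x; apply: le_trans (ler_normB _ _) _; rewrite mulrDl.
have x1 : 1 <= 1 + `|x| by rewrite lerDl.
apply: lerD; [apply: le_trans (Hf x) _|apply: le_trans (Hg x) _];
  by rewrite ler_wpM2l// ler_weXn2l// ?leq_maxl ?leq_maxr.
Qed.

Lemma poly_growth_id : poly_growth id.
Proof. by exists (1, 1%N) => //= x; rewrite expr1 mul1r lerDr. Qed.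

Lemma poly_growth_integrable f : measurable_fun setT f -> poly_growth f ->
  mu.-integrable setT (fun x => (f x * phi x)%:E).
Proof.
move=> mf [[C r] /= C0 Hf]; have [D D0 HD] := poly_pdf01_le r.
have mphi : measurable_fun setT phi by exact: measurable_normal_pdf.
apply: (@le_integrable _ _ _ mu setT _ _ (fun x => (C * D * normal_pdf 0 2 x)%:E)) => //.
- by apply/measurable_EFinP; apply: measurable_funM.
- move=> x _; rewrite /= lee_fin normrM (ger0_norm (normal_pdf_ge0 0 1 x)).
  rewrite [leRHS]ger0_norm ?mulr_ge0 ?normal_pdf_ge0//.
  apply: (@le_trans _ _ (C * (1 + `|x|) ^+ r * phi x)).
    by rewrite ler_wpM2r ?normal_pdf_ge0 ?Hf.
  by rewrite -!mulrA ler_wpM2l ?HD.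
- under eq_fun do rewrite EFinM.
  by apply: integrableZl => //; exact: integrable_normal_pdf.
Qed.

Lemma poly_growth_normal_integrable f : measurable_fun setT f -> poly_growth f ->
  gamma.-integrable setT (EFin \o f).
Proof.
move=> mf gf; apply/integrableP; split; first exact/measurable_EFinP.
rewrite ge0_integral_normal_prob//; last first.
  by apply: measurableT_comp => //; exact/measurable_EFinP.
have /integrableP[_] := poly_growth_integrable mf gf.
apply: le_lt_trans; rewrite le_eqVlt; apply/orP; left; apply/eqP.
apply: eq_integral => x _ /=.
by rewrite normrM (ger0_norm (normal_pdf_ge0 0 1 x)) ?EFinM.
Qed.

Lemma cvg_pdf02 : normal_pdf (0 : R) 2 n%:R @[n --> \oo] --> (0 : R).
Proof.
have p2 : 0 < normal_peak 2 :> R by exact: normal_peak_gt0.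
apply: (@squeeze_cvgr _ _ _ _ (fun=> 0)
    (fun n => normal_peak 2 * expR 2 * expR (- n%:R))).
- apply: nearW => n; rewrite normal_pdf_ge0/= normal_pdfE// /normal_fun subr0.
  rewrite -mulrA ler_wpM2l ?(ltW p2)// -expRD ler_expR.
  have -> : - n%:R ^+ 2 / (2 ^+ 2 *+ 2) = - (n%:R ^+ 2 / 8) :> R by rewrite -mulr_natr; field.
  by have := sqr_ge0 (n%:R - 4 : R); lra.
- exact: cvg_cst.
- rewrite -[X in _ --> X](mulr0 (normal_peak 2 * expR 2)).
  by apply: cvgM; [exact: cvg_cst|exact: cvgn_expR].
Qed.

(** Stein's identity: (F phi)' = (F' - x F) phi integrates to boundary terms, which vanish at
    infinity by polynomial growth of [F]. *)
Lemma gauss_ibp (F F' : R -> R) : (forall x, is_derive x (1 : R) F (F' x)) ->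
  continuous F' -> poly_growth F -> poly_growth F' ->
  \int[gamma]_x (x * F x) = \int[gamma]_x F' x.
Proof.
move=> dF cF' gF gF'.
have cF : continuous F.
  by move=> x; apply: differentiable_continuous; apply/derivable1_diffP; case: (dF x).
have mF : measurable_fun setT F by exact: continuous_measurable_fun.
have mF' : measurable_fun setT F' by exact: continuous_measurable_fun.
have gxF : poly_growth (fun x => x * F x) by exact: poly_growthM poly_growth_id gF.
have mxF : measurable_fun setT (fun x : R => x * F x) by exact: measurable_funM.
have mphi : measurable_fun setT phi by exact: measurable_normal_pdf.
pose H x := F x * phi x.
pose h x := (F' x - x * F x) * phi x.
have dH x : is_derive x (1 : R) H (h x).
  have dp := is_derive_pdf01 x; have dFx := dF x.
  by apply: is_derive_eq; rewrite /h /GRing.scale /=; ring.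
have ch : continuous h.
  move=> x; apply: cvgM; last exact: continuous_normal_pdf.
  by apply: cvgB; [exact: cF'|apply: cvgM; [exact: cvg_id|exact: cF]].
have cH : continuous H.
  by move=> x; apply: cvgM; [exact: cF|exact: continuous_normal_pdf].
have ih : mu.-integrable setT (EFin \o h).
  apply: (@poly_growth_integrable (fun x => F' x - x * F x)).
    exact: measurable_funB.
  exact: poly_growthB gF' gxF.
(* [n.+1] keeps the interval nondegenerate at the first index. *)
have ftc (n : nat) : (\int[mu]_(x in `[(- n.+1%:R)%R, n.+1%:R]) (h x)%:E =
    (H n.+1%:R - H (- n.+1%:R))%:E)%E.
  rewrite EFinB; apply: continuous_FTC2.
  - by rewrite gtrN.
  - exact: continuous_subspaceT.
  - split=> [x _||].
    + by case: (dH x).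
    + by apply: cvg_at_right_filter; exact: cH.
    + by apply: cvg_at_left_filter; exact: cH.
  - by move=> x _; rewrite derive1E; case: (dH x).
have bd : (fun n : nat => H n.+1%:R - H (- n.+1%:R)) @ \oo --> (0 : R).
  have [[C r] /= C0 HF] := gF; have [D D0 HD] := poly_pdf01_le r.
  have Hle x : `|H x| <= C * D * normal_pdf 0 2 `|x|.
    have -> : normal_pdf 0 2 `|x| = normal_pdf 0 2 x :> R.
      by rewrite !normal_pdfE// /normal_fun !subr0 real_normK ?num_real.
    rewrite normrM (ger0_norm (normal_pdf_ge0 0 1 x)).
    apply: (@le_trans _ _ (C * (1 + `|x|) ^+ r * phi x)).
      by rewrite ler_wpM2r ?normal_pdf_ge0 ?HF.
    by rewrite -!mulrA ler_wpM2l ?HD.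
  have z : C * D * normal_pdf 0 2 n.+1%:R @[n --> \oo] --> (0 : R).
    rewrite -[X in _ --> X](mulr0 (C * D)).
    by apply: cvgM; [exact: cvg_cst|rewrite (cvg_shiftS (fun n => normal_pdf 0 2 n%:R : R)); exact: cvg_pdf02].
  have z1 : H n.+1%:R @[n --> \oo] --> (0 : R).
    apply: norm_cvg0; apply: (squeeze_cvgr _ (cvg_cst 0) z).
    by apply: nearW => n; rewrite normr_ge0/=; have := Hle n.+1%:R; rewrite normr_nat.
  have z2 : H (- n.+1%:R) @[n --> \oo] --> (0 : R).
    apply: norm_cvg0; apply: (squeeze_cvgr _ (cvg_cst 0) z).
    by apply: nearW => n; rewrite normr_ge0/=; have := Hle (- n.+1%:R); rewrite normrN normr_nat.
  by rewrite -[X in _ --> X](subrr 0); exact: cvgB.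
(* Truncations of [h] to growing intervals are dominated by |h|; their integrals tend both to the
   full integral and, by [bd], to 0. *)
have h0 : (\int[mu]_x (h x)%:E = 0)%E.
  pose S (n : nat) : set R := [set` `[(- n.+1%:R : R), n.+1%:R]].
  have mS n : measurable (S n) by exact: measurable_itv.
  have [] := @dominated_convergence _ _ _ mu setT measurableT
    (fun n => (EFin \o h) \_ (S n)) (EFin \o h) (abse \o (EFin \o h)).
  - move=> n; apply: ((measurable_restrictT (EFin \o h) (mS n)).1 _).
    exact: measurable_funTS (measurable_int mu ih).
  - exact: (measurable_int mu ih).
  - apply: aeW => x _; apply: cvg_near_cst.
    near=> n; rewrite patchE ifT// inE /S /= in_itv /= -ler_norml.
    apply: (@le_trans _ _ n%:R); last by rewrite ler_nat.
    by near: n; exact: nbhs_infty_ger.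
  - exact: integrable_abse.
  - apply: aeW => x n _; rewrite patchE; case: ifP => _; first exact: lexx.
    by rewrite -[point]/0%E abse0 /= lee_fin.
  move=> _ _ lim1.
  have lim2 : (fun n => (\int[mu]_x ((EFin \o h) \_ (S n)) x)%E) @ \oo --> (0 : \bar R)%E.
    rewrite (_ : (fun n => _) = (fun n => (H n.+1%:R - H (- n.+1%:R))%:E)).
      by apply: cvg_EFin; [exact: nearW|exact: bd].
    by apply/funext => n; rewrite -integral_mkcond ftc.
  exact: (cvg_unique _ lim1 lim2).
have e1 : \int[gamma]_x (x * F x) = \int[mu]_x (x * F x * phi x).
  by rewrite /Rintegral integral_normal_prob//; exact: poly_growth_normal_integrable.
have e2 : \int[gamma]_x F' x = \int[mu]_x (F' x * phi x).
  by rewrite /Rintegral integral_normal_prob//; exact: poly_growth_normal_integrable.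
rewrite e1 e2; apply/esym/subr0_eq.
rewrite -RintegralB//; [|exact: poly_growth_integrable..].
rewrite /Rintegral -[RHS]/(fine 0%E) -h0; congr fine; apply: eq_integral => x _.
by rewrite /h mulrBl.
Unshelve. all: by end_near.
Qed.

End gauss1.

(** * Gaussian matrices: resampling, integrability, integration by parts in one entry *)

Section matrix_space.
Context {R : realType} (l m : nat).

(* The library puts no sigma-algebra on matrices: use the one generated by the
   sets that [gaussian_matrix] speaks about. *)
Definition rectangles : set (set 'M[R]_(l, m)) :=
  [set E : set 'M[R]_(l, m) | exists2 B : 'I_l -> 'I_m -> set R,
    forall i j, measurable (B i j) &
    E = [set M : 'M[R]_(l, m) | forall i j, B i j (M i j)]].

Local Notation mat := (g_sigma_algebraType rectangles).

Lemma setI_rectangles : setI_closed rectangles.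
Proof.
move=> _ _ [B mB ->] [C mC ->]; exists (fun i j => B i j `&` C i j).
  by move=> i j; exact: measurableI.
by apply/seteqP; split=> [M [HB HC] i j|M H]; [split; [exact: HB|exact: HC]|split=> i j; case: (H i j)].
Qed.

Lemma rectanglesT : rectangles setT.
Proof. by exists (fun _ _ => setT) => //; apply/seteqP; split. Qed.

Lemma measurable_to_mat d (T : measurableType d) (f : T -> mat) :
  measurable_mx f -> measurable_fun setT f.
Proof.
move=> mf; apply: (@measurability _ _ T mat setT f rectangles) => // _ [_ [B mB ->] <-].
rewrite setTI.
rewrite (_ : _ @^-1` _ =
    [set w | forall ij : 'I_l * 'I_m, ((fun w => f w ij.1 ij.2) @^-1` B ij.1 ij.2) w]).
  apply: countable_forall_measurable => ij.
  by rewrite -[X in measurable X]setTI; exact: mf.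
by apply/seteqP; split=> [w H [i j]|w H i j]; [exact: H|exact: (H (i, j))].
Qed.

Lemma measurable_mat_entry : measurable_mx (id : mat -> 'M[R]_(l, m)).
Proof.
move=> i j _ B mB; rewrite setTI; apply: sub_sigma_algebra.
exists (fun a b => if (a == i) && (b == j) then B else setT).
  by move=> a b; case: ifP.
apply/seteqP; split=> [M BM a b|M H].
  by case: ifP => // /andP[/eqP -> /eqP ->].
by have := H i j; rewrite !eqxx.
Qed.

(** Serves twice: to replace an entry by a fresh variable, and as the coordinate line along which
    partial derivatives are taken. *)
Definition set_entry (i : 'I_l) (j : 'I_m) (M : 'M[R]_(l, m)) (x : R) : 'M[R]_(l, m) :=
  \matrix_(a, b) if (a == i) && (b == j) then x else M a b.

Lemma set_entryE i j M x : set_entry i j M x i j = x.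
Proof. by rewrite mxE !eqxx. Qed.

End matrix_space.
Arguments rectangles {R l m}.

Section resampling.
Context {R : realType} d (T : measurableType d) (P : probability T R) (l m : nat).
Variable Om : T -> 'M[R]_(l, m).
Hypothesis gOm : gaussian_matrix P Om.
Local Notation mat := (g_sigma_algebraType (@rectangles R l m)).
Local Notation gamma := (normal_prob (0 : R) 1).

Lemma gaussian_measurable_mx : measurable_mx Om.
Proof. by case: gOm. Qed.

Definition resample (i : 'I_l) (j : 'I_m) (z : T * measurableTypeR R) : mat := set_entry i j (Om z.1) z.2.

Lemma measurable_resample i j : measurable_fun setT (resample i j).
Proof.
apply: measurable_to_mat => a b; rewrite /resample; under eq_fun do rewrite mxE.
case: ((a == i) && (b == j)); first exact: measurable_snd.
exact: (measurableT_comp (gaussian_measurable_mx a b) measurable_fst).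
Qed.

Lemma gaussian_measurable_mat : measurable_fun setT (Om : T -> mat).
Proof. by apply: measurable_to_mat; exact: gaussian_measurable_mx. Qed.

Let X : {mfun T >-> mat} :=
  HB.pack (Om : T -> mat) (isMeasurableFun.Build _ _ _ _ _ gaussian_measurable_mat).
Let Y (i : 'I_l) (j : 'I_m) : {mfun (T * measurableTypeR R)%type >-> mat} :=
  HB.pack (resample i j) (isMeasurableFun.Build _ _ _ _ _ (measurable_resample i j)).

(* Independence of the entries: the law of a Gaussian matrix does not change when
   one entry is replaced by a fresh normal variable.  This is what reduces
   integration by parts to one variable. *)
Lemma resample_law (i : 'I_l) (j : 'I_m) (E : set mat) : measurable E ->
  distribution P X E = distribution (P \x gamma)%E (Y i j) E.
Proof.
move=> mE; apply: (@measure_unique _ R mat rectangles (fun=> setT) erefl (setI_rectangles (m:=m))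
  (fun=> rectanglesT l m) _ (distribution P X) (distribution (P \x gamma)%E (Y i j))) => //.
- by rewrite bigcup_const//; exists 0%N.
- move=> _ [B mB ->].
  (* [B'] drops the constraint on entry (i, j). The preimage of a rectangle under [resample] is then
     a product set, and the (i, j) factor of its [P]-measure is 1. *)
  pose B' (a : 'I_l) (b : 'I_m) : set R := if (a == i) && (b == j) then setT else B a b.
  have mB' a b : measurable (B' a b) by rewrite /B'; case: ifP.
  have [_ law ind] := gOm.
  have split : resample i j @^-1` [set M : 'M[R]_(l, m) | forall (a : 'I_l) (b : 'I_m), B a b (M a b)] =
      [set w | forall (a : 'I_l) (b : 'I_m), B' a b (Om w a b)] `*` B i j.
    apply/seteqP; split=> [[w x] /= H|[w x] /= [H Bx] a b].
      split=> [a b|]; last by have := H i j; rewrite /resample set_entryE.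
      by rewrite /B'; case: ifP => // ab; have := H a b; rewrite mxE ab.
    rewrite mxE; case: ifP => [/andP[/eqP -> /eqP ->]//|ab].
    by have := H a b; rewrite /B' ab.
  have mB'Om : measurable [set w | forall (a : 'I_l) (b : 'I_m), B' a b (Om w a b)].
    rewrite (_ : mkset _ = [set w | forall ab : 'I_l * 'I_m,
        ((fun w => Om w ab.1 ab.2) @^-1` B' ab.1 ab.2) w]).
      apply: countable_forall_measurable => ab.
      by rewrite -[X in measurable X]setTI; exact: gaussian_measurable_mx.
    by apply/seteqP; split=> [w H [a b]|w H a b]; [exact: H|exact: (H (a, b))].
  transitivity (P [set w | forall (a : 'I_l) (b : 'I_m), B a b (Om w a b)]); first by [].
  transitivity ((P \x gamma)%E
    (resample i j @^-1` [set M : 'M[R]_(l, m) | forall (a : 'I_l) (b : 'I_m), B a b (M a b)])); last by [].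
  transitivity (P [set w | forall (a : 'I_l) (b : 'I_m), B' a b (Om w a b)] *
    gamma (B i j))%E; last first.
    by rewrite split product_measure1E; [|exact: mB'Om|exact: mB].
  rewrite (ind B' mB') (ind B mB) !pair_big /=.
  rewrite (bigD1 (i, j))//= [in RHS](bigD1 (i, j))//=.
  have -> : B' i j = setT by rewrite /B' !eqxx.
  rewrite preimage_setT probability_setT mul1e muleC -(law i j _ (mB i j)).
  congr (_ * _)%E.
  apply: eq_bigr => -[a b] /= ab; congr (P (_ @^-1` _)).
  by rewrite /B'; case: ifP => // /andP[/eqP ai /eqP bj]; rewrite ai bj eqxx in ab.
- by move=> _; rewrite -[X in (X < _)%E]/(P setT) probability_setT ltry.
Qed.

(** Equal laws give equal integrals, and Fubini isolates the fresh variable. Integrability over the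
    product comes from applying the same equality of laws to the absolute value. *)
Lemma integral_resample (i : 'I_l) (j : 'I_m) (f : mat -> R) : measurable_fun setT f ->
  P.-integrable setT (fun w => (f (Om w))%:E) ->
  (\int[P]_w (f (Om w))%:E = \int[P]_w \int[gamma]_x (f (set_entry i j (Om w) x))%:E)%E.
Proof.
move=> mf intf.
have mf' : measurable_fun setT (EFin \o f) by exact/measurable_EFinP.
have eqm (g : mat -> \bar R) :
    (\int[distribution P X]_M g M = \int[distribution (P \x gamma)%E (Y i j)]_M g M)%E.
  by apply: eq_measure_integral => E mE _; exact: resample_law.
have intY : (P \x gamma)%E.-integrable setT ((EFin \o f) \o Y i j).
  apply/integrableP; split.
    by apply: measurableT_comp => //; exact: measurable_resample.
  have /integrableP[_] := intf.
  have mabs : measurable_fun setT (fun M : mat => `|(f M)%:E|%E) by exact: measurableT_comp.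
  have := @ge0_integral_distribution _ _ _ _ _ P X _ mabs (fun=> abse_ge0 _).
  rewrite eqm => <-.
  by rewrite ge0_integral_distribution.
have := @integral_distribution _ _ _ _ _ P X (EFin \o f) mf' intf.
rewrite eqm integral_distribution// => <-.
by rewrite -integral12_prod_meas1.
Qed.

End resampling.

Section tame_functions.
Context {R : realType} (l m : nat).
Local Notation mat := (g_sigma_algebraType (@rectangles R l m)).
Implicit Types (f g : 'M[R]_(l, m) -> R) (M : 'M[R]_(l, m)).

Definition mx_norm1 M := \sum_(ij : 'I_l * 'I_m) `|M ij.1 ij.2|.

Lemma mx_norm1_ge0 M : 0 <= mx_norm1 M.
Proof. exact: sumr_ge0. Qed.

Lemma le_mx_norm1 M i j : `|M i j| <= mx_norm1 M.
Proof. by rewrite /mx_norm1 (bigD1 (i, j))//= lerDl sumr_ge0. Qed.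

(** Turns polynomial growth in the matrix into polynomial growth along a line, as [gauss_ibp]
    requires. *)
Lemma mx_norm1_set_entry i j M x : mx_norm1 (set_entry i j M x) <= mx_norm1 M + `|x|.
Proof.
rewrite /mx_norm1 (bigD1 (i, j))//= set_entryE addrC lerD2r.
rewrite [leRHS](bigD1 (i, j))//=; apply: ler_wpDl => //.
apply: ler_sum => -[a b] /= ab; rewrite mxE; case: ifP => // /andP[/eqP ai /eqP bj].
by rewrite ai bj eqxx in ab.
Qed.

Definition mx_growth f := exists2 Cr : R * nat, 0 <= Cr.1 &
  forall M, `|f M| <= Cr.1 * (1 + mx_norm1 M) ^+ Cr.2.

(* Continuity is only required along the lines that move a single entry. *)
Definition tame f := [/\ measurable_fun setT (f : mat -> R), mx_growth f &
  forall i j M, continuous (fun x => f (set_entry i j M x))].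

Let norm1_ge1 M : 1 <= 1 + mx_norm1 M.
Proof. by rewrite lerDl mx_norm1_ge0. Qed.

Lemma tame_cst (c : R) : tame (fun=> c).
Proof.
split; first exact: measurable_cst.
- by exists (`|c|, 0%N) => //= M; rewrite expr0 mulr1.
- by move=> i j M x; exact: cvg_cst.
Qed.

Lemma tame_entry i j : tame (fun M => M i j).
Proof.
split; first exact: measurable_mat_entry.
- by exists (1, 1%N) => //= M; rewrite expr1 mul1r ler_wpDl ?le_mx_norm1.
- move=> a b M x; under eq_fun do rewrite mxE.
  by case: (_ && _); [exact: cvg_id|exact: cvg_cst].
Qed.

Lemma tameM f g : tame f -> tame g -> tame (fun M => f M * g M).
Proof.
move=> [mf [[C r] /= C0 Hf] cf] [mg [[D q] /= D0 Hg] cg]; split.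
- exact: measurable_funM.
- exists (C * D, (r + q)%N) => /=; first exact: mulr_ge0.
  by move=> M; rewrite normrM exprD mulrACA; apply: ler_pM.
- by move=> i j M x; apply: cvgM; [exact: cf|exact: cg].
Qed.

Lemma tameD f g : tame f -> tame g -> tame (fun M => f M + g M).
Proof.
move=> [mf [[C r] /= C0 Hf] cf] [mg [[D q] /= D0 Hg] cg]; split.
- exact: measurable_funD.
- exists (C + D, maxn r q) => /=; first exact: addr_ge0.
  move=> M; apply: le_trans (ler_normD _ _) _; rewrite mulrDl.
  apply: lerD; [apply: le_trans (Hf M) _|apply: le_trans (Hg M) _];
    by rewrite ler_wpM2l// ler_weXn2l// ?leq_maxl ?leq_maxr.
- by move=> i j M x; apply: cvgD; [exact: cf|exact: cg].
Qed.

Lemma tameN f : tame f -> tame (fun M => - f M).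
Proof.
move=> tf; rewrite (_ : (fun M => _) = (fun M => -1 * f M)).
  by apply: tameM => //; exact: tame_cst.
by apply/funext => M; rewrite mulN1r.
Qed.

Lemma tameB f g : tame f -> tame g -> tame (fun M => f M - g M).
Proof. by move=> tf tg; apply: tameD => //; exact: tameN. Qed.

Lemma tameX f p : tame f -> tame (fun M => f M ^+ p).
Proof.
move=> tf; elim: p => [|p IH]; first exact: tame_cst.
by under eq_fun do rewrite exprS; exact: tameM.
Qed.

Lemma tame_sum (I : Type) (s : seq I) (F : I -> 'M[R]_(l, m) -> R) :
  (forall i, tame (F i)) -> tame (fun M => \sum_(i <- s) F i M).
Proof.
move=> tF; elim: s => [|i s IH].
  by under eq_fun do rewrite big_nil; exact: tame_cst.
by under eq_fun do rewrite big_cons; exact: tameD.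
Qed.

End tame_functions.

Section gaussian_integrability.
Context {R : realType} d (T : measurableType d) (P : probability T R) (l m : nat).
Variable Om : T -> 'M[R]_(l, m).
Hypothesis gOm : gaussian_matrix P Om.
Local Notation mat := (g_sigma_algebraType (@rectangles R l m)).
Local Notation gamma := (normal_prob (0 : R) 1).

(** Reduces integrability of a function of all entries to moments of single entries. The larger of
    two summands is at least half of the total, whence the factor 2^r at each step. *)
Lemma sum_powr_le (I : Type) (s : seq I) (r : nat) : exists2 C : R, 0 <= C &
  forall x : I -> R, (forall i, 0 <= x i) ->
    (1 + \sum_(i <- s) x i) ^+ r <= C * (1 + \sum_(i <- s) x i ^+ r).
Proof.
elim: s => [|i s [C C0 IH]].
  by exists 1 => // x _; rewrite !big_nil addr0 expr1n mulr1.
exists (2 ^+ r * (C + 1)) => [|x x0]; first by rewrite mulr_ge0 ?addr_ge0.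
rewrite !big_cons.
set S := \sum_(_ <- s) _; set S' := \sum_(_ <- s) _.
have S0 : 0 <= S by exact: sumr_ge0.
have S'0 : 0 <= S' by apply: sumr_ge0 => j _; rewrite exprn_ge0.
have h : (1 + (x i + S)) ^+ r <= 2 ^+ r * ((1 + S) ^+ r + x i ^+ r).
  have [xS|Sx] := leP (x i) (1 + S).
    apply: (@le_trans _ _ ((2 * (1 + S)) ^+ r)).
      by apply: lerXn2r; rewrite ?nnegrE; have := x0 i; lra.
    by rewrite exprMn ler_wpM2l ?exprn_ge0// lerDl exprn_ge0.
  apply: (@le_trans _ _ ((2 * x i) ^+ r)).
    by apply: lerXn2r; rewrite ?nnegrE; have := x0 i; lra.
  by rewrite exprMn ler_wpM2l ?exprn_ge0// lerDr exprn_ge0//; lra.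
apply: le_trans h _; rewrite -mulrA ler_wpM2l ?exprn_ge0//.
have := IH x x0; rewrite -/S -/S' => H.
have : 0 <= x i ^+ r by rewrite exprn_ge0.
nra.
Qed.

Lemma entry_moment_lty i j (r : nat) :
  (\int[P]_w (`|Om w i j| ^+ r)%:E < +oo)%E.
Proof.
have mX : measurable_fun setT (fun w => Om w i j : measurableTypeR R).
  by move=> mT Y mY; exact: (gaussian_measurable_mx gOm i j mT mY).
pose X : {mfun T >-> measurableTypeR R} :=
  HB.pack (fun w => Om w i j : measurableTypeR R) (isMeasurableFun.Build _ _ _ _ _ mX).
have mg : measurable_fun setT (fun x : R => (`|x| ^+ r)%:E).
  by apply/measurable_EFinP; apply: measurable_funX; exact: normr_measurable.
have -> : (\int[P]_w (`|Om w i j| ^+ r)%:E = \int[gamma]_x (`|x| ^+ r)%:E)%E.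
  have g0 (x : R) : (0 <= (`|x| ^+ r)%:E)%E by rewrite lee_fin exprn_ge0.
  transitivity (\int[distribution P X]_x (`|x| ^+ r)%:E)%E.
    by rewrite (ge0_integral_distribution X mg g0).
  apply: eq_measure_integral => E mE _.
  by have [_ law _] := gOm; exact: law.
have gf : poly_growth (fun x : R => `|x| ^+ r).
  exists (1, r) => //= x; rewrite ger0_norm ?exprn_ge0// mul1r.
  by apply: lerXn2r; rewrite ?nnegrE// ?addr_ge0// lerDr.
have mf : measurable_fun setT (fun x : R => `|x| ^+ r).
  by apply: measurable_funX; exact: normr_measurable.
have /integrableP[_] := poly_growth_normal_integrable mf gf.
apply: le_lt_trans; rewrite le_eqVlt; apply/orP; left; apply/eqP.
by apply: eq_integral => x _ /=; rewrite (ger0_norm (exprn_ge0 r (normr_ge0 x))).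
Qed.

Lemma tame_integrable (f : 'M[R]_(l, m) -> R) : tame f ->
  P.-integrable setT (fun w => (f (Om w))%:E).
Proof.
move=> [mf [[C r] /= C0 Hf] _].
have mfO : measurable_fun setT (fun w => f (Om w)).
  exact: (measurableT_comp mf (gaussian_measurable_mat gOm)).
have [D D0 HD] := sum_powr_le (index_enum ('I_l * 'I_m)%type) r.
have mO := gaussian_measurable_mx gOm.
have mpow (ij : 'I_l * 'I_m) : measurable_fun setT (fun w => `|Om w ij.1 ij.2| ^+ r).
  by apply: measurable_funX; apply: measurableT_comp => //; exact: mO.
pose B w := C * D * (1 + \sum_ij `|Om w ij.1 ij.2| ^+ r).
have int_pow : P.-integrable setT (fun w => (\sum_ij `|Om w ij.1 ij.2| ^+ r)%:E).
  under eq_fun do rewrite -sumEFin.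
  apply: integrable_sum => // ij _.
  apply/integrableP; split; first exact/measurable_EFinP.
  under eq_integral do rewrite /= (ger0_norm (exprn_ge0 r (normr_ge0 _))).
  exact: entry_moment_lty.
have intB : P.-integrable setT (fun w => (B w)%:E).
  rewrite /B; under eq_fun do rewrite EFinM EFinD.
  apply: integrableZl => //; apply: integrableD => //.
  exact: finite_measure_integrable_cst.
apply: (le_integrable measurableT _ _ intB); first exact/measurable_EFinP.
move=> w _; rewrite /= lee_fin; apply: le_trans (Hf _) _.
rewrite [leRHS]ger0_norm; last first.
  by rewrite !mulr_ge0 ?addr_ge0// sumr_ge0// => ij _; rewrite exprn_ge0.
by rewrite /B -mulrA ler_wpM2l// HD.
Qed.

(** Resampling entry (i, j) makes both sides iterated integrals whose inner variable is a single
    normal one; [gauss_ibp] equates the inner integrals for each fixed [w]. *)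
Lemma matrix_ibp i j (f f' : 'M[R]_(l, m) -> R) : tame f -> tame f' ->
  (forall M x, is_derive x (1 : R) (fun x => f (set_entry i j M x))
    (f' (set_entry i j M x))) ->
  \int[P]_w (Om w i j * f (Om w)) = \int[P]_w (f' (Om w)).
Proof.
move=> tf tf' df; have tg := tameM (tame_entry i j) tf.
rewrite /Rintegral; congr fine.
have [mg _ _] := tg; have [mf' gf' cf'] := tf'; have [mf gf cf] := tf.
rewrite (integral_resample gOm i j mg (tame_integrable tg)).
rewrite (integral_resample gOm i j mf' (tame_integrable tf')).
apply: eq_integral => w _.
have line g : mx_growth g -> poly_growth (fun x => g (set_entry i j (Om w) x)).
  move=> [[C r] /= C0 Hg]; exists (C * (1 + mx_norm1 (Om w)) ^+ r, r) => /=.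
    by rewrite mulr_ge0// exprn_ge0// addr_ge0// mx_norm1_ge0.
  move=> x; apply: le_trans (Hg _) _; rewrite -mulrA ler_wpM2l// -exprMn.
  have n0 := mx_norm1_ge0 (Om w); have n1 := mx_norm1_set_entry i j (Om w) x.
  have n2 := mx_norm1_ge0 (set_entry i j (Om w) x); have x0 := normr_ge0 x.
  by apply: lerXn2r; rewrite ?nnegrE; nra.
have ibp := gauss_ibp (df (Om w)) (cf' i j (Om w)) (line f gf) (line f' gf').
under eq_integral do rewrite set_entryE.
have mF : measurable_fun setT (fun x => f (set_entry i j (Om w) x)).
  exact: continuous_measurable_fun.
have mF' : measurable_fun setT (fun x => f' (set_entry i j (Om w) x)).
  exact: continuous_measurable_fun.
have mxF : measurable_fun setT (fun x : R => x * f (set_entry i j (Om w) x)).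
  exact: measurable_funM.
have i1 := poly_growth_normal_integrable mxF
  (poly_growthM poly_growth_id (line f gf)).
have i2 := poly_growth_normal_integrable mF' (line f' gf').
rewrite -[LHS]fineK; last exact: (integrable_fin_num measurableT i1).
rewrite -[RHS]fineK; last exact: (integrable_fin_num measurableT i2).
by congr EFin.
Qed.

End gaussian_integrability.

(** * Gaussian divergence identity and moments of linear images *)

Section pointwise_derivatives.
Context {R : realType}.
Implicit Types (f g : R -> R) (x a b : R).

Lemma is_derive_mulf f g x a b : is_derive x (1 : R) f a -> is_derive x (1 : R) g b ->
  is_derive x (1 : R) (fun y => f y * g y) (a * g x + f x * b).
Proof.
move=> df dg; apply: (is_derive_eq (is_deriveM df dg)); rewrite /GRing.scale /=; ring.
Qed.

Lemma is_derive_addf f g x a b : is_derive x (1 : R) f a -> is_derive x (1 : R) g b ->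
  is_derive x (1 : R) (fun y => f y + g y) (a + b).
Proof. exact: is_deriveD. Qed.

Lemma is_derive_sumf (I : Type) (s : seq I) (F : I -> R -> R) (F' : I -> R) x :
  (forall i, is_derive x (1 : R) (F i) (F' i)) ->
  is_derive x (1 : R) (fun y => \sum_(i <- s) F i y) (\sum_(i <- s) F' i).
Proof.
move=> dF; elim: s => [|i s IH].
  by under eq_fun do rewrite big_nil; rewrite big_nil; exact: is_derive_cst.
by under eq_fun do rewrite big_cons; rewrite big_cons; exact: is_derive_addf.
Qed.

Lemma is_derive_expf f x a (p : nat) : is_derive x (1 : R) f a ->
  is_derive x (1 : R) (fun y => f y ^+ p) (p%:R * f x ^+ p.-1 * a).
Proof.
move=> df; elim: p => [|p IH]; first by rewrite mul0r mul0r; exact: is_derive_cst.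
under eq_fun do rewrite exprS.
apply: (is_derive_eq (is_derive_mulf df IH)).
case: p {IH} => [|p]; first by rewrite !expr0 !mul0r mulr0 addr0; ring.
by rewrite /= exprS -!natr1; ring.
Qed.

Lemma is_derive_affine x (u v : R) : is_derive x (1 : R) (fun y => u + v * y) v.
Proof.
have h := is_derive_addf (is_derive_cst u x 1)
  (is_derive_mulf (is_derive_cst v x 1) (is_derive_id x 1)).
by apply: (is_derive_eq h); rewrite /= mul0r !add0r mulr1.
Qed.

End pointwise_derivatives.

Section gaussian_expectation.
Context {R : realType} d (T : measurableType d) (P : probability T R) (l m : nat).
Variable Om : T -> 'M[R]_(l, m).
Hypothesis gOm : gaussian_matrix P Om.
Implicit Types f g : 'M[R]_(l, m) -> R.

Definition gexp f : R := \int[P]_w (f (Om w)).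

Lemma gexp_cst (c : R) : gexp (fun=> c) = c.
Proof.
rewrite /gexp Rintegral_cst//.
by rewrite (_ : fine _ = fine (P setT))// probability_setT mulr1.
Qed.

Lemma gexpD f g : tame f -> tame g -> gexp (fun M => f M + g M) = gexp f + gexp g.
Proof. by move=> tf tg; apply: RintegralD => //; apply: (tame_integrable gOm). Qed.

Lemma gexpZ (c : R) f : tame f -> gexp (fun M => c * f M) = c * gexp f.
Proof. by move=> tf; apply: RintegralZl => //; apply: (tame_integrable gOm). Qed.

Lemma gexp_sum (I : Type) (s : seq I) (F : I -> 'M[R]_(l, m) -> R) :
  (forall i, tame (F i)) ->
  gexp (fun M => \sum_(i <- s) F i M) = \sum_(i <- s) gexp (F i).
Proof.
move=> tF; elim: s => [|i s IH].
  by rewrite big_nil -[RHS](gexp_cst 0); congr gexp; apply/funext => M; rewrite big_nil.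
rewrite big_cons -IH -gexpD//; last exact: tame_sum.
by congr gexp; apply/funext => M; rewrite big_cons.
Qed.

Lemma le_gexp f g : tame f -> tame g -> (forall M, f M <= g M) -> gexp f <= gexp g.
Proof.
by move=> tf tg fg; apply: le_Rintegral => //; apply: (tame_integrable gOm).
Qed.

Lemma EFin_gexp f : tame f -> (gexp f)%:E = (\int[P]_w (f (Om w))%:E)%E.
Proof.
move=> tf; rewrite /gexp /Rintegral fineK//.
exact: (integrable_fin_num measurableT (tame_integrable gOm tf)).
Qed.

(** [F' i j] differentiates [F i j] in its own entry only, so the right-hand side is the expected
    divergence of the field [F]. *)
Lemma gexp_divergence (F F' : 'I_l -> 'I_m -> 'M[R]_(l, m) -> R) :
  (forall i j, tame (F i j)) -> (forall i j, tame (F' i j)) ->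
  (forall i j M x, is_derive x (1 : R) (fun x => F i j (set_entry i j M x))
    (F' i j (set_entry i j M x))) ->
  gexp (fun M => \sum_i \sum_j M i j * F i j M) =
  gexp (fun M => \sum_i \sum_j F' i j M).
Proof.
move=> tF tF' dF.
have tMF i j : tame (fun M => M i j * F i j M).
  by apply: tameM => //; exact: tame_entry.
rewrite gexp_sum => [|i]; last exact: tame_sum.
rewrite gexp_sum => [|i]; last exact: tame_sum.
apply: eq_bigr => i _; rewrite !gexp_sum//; apply: eq_bigr => j _.
exact: matrix_ibp.
Qed.

Section linear_image.
Variables (n : nat) (c : 'I_n -> 'M[R]_(l, m)) (tau : R).
Hypothesis orth : forall a b, \sum_i \sum_j c a i j * c b i j = tau *+ (a == b).

Let W a (M : 'M[R]_(l, m)) := \sum_i \sum_j c a i j * M i j.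
Let N (M : 'M[R]_(l, m)) := \sum_a W a M ^+ 2.

Let tameW a : tame (W a).
Proof.
by apply: tame_sum => i; apply: tame_sum => j; apply: tameM; [exact: tame_cst|exact: tame_entry].
Qed.

Let tameN2 : tame N.
Proof. by apply: tame_sum => a; exact: tameX. Qed.

Let dW a i j M x :
  is_derive x (1 : R) (fun x => W a (set_entry i j M x)) (c a i j).
Proof.
have -> : (fun x => W a (set_entry i j M x)) =
    (fun x => W a (set_entry i j M 0) + c a i j * x).
  apply/funext => y; rewrite /W (bigD1 i)//= [in RHS](bigD1 i)//=.
  rewrite (bigD1 j)//= [in RHS](bigD1 j)//= !set_entryE mulr0 add0r.
  rewrite -!addrA addrC -!addrA; congr (_ + _).
    by apply: eq_bigr => b bj; rewrite !mxE (negbTE bj) andbF.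
  congr (_ + _); apply: eq_bigr => a' ai; apply: eq_bigr => b _.
  by rewrite !mxE (negbTE ai).
exact: is_derive_affine.
Qed.

(** By [orth] the [W a] are uncorrelated normals of variance [tau], so these are the moments of tau
    times a chi-squared variable with [n] degrees of freedom. The induction uses the field N^p sum_a
    (W a) c_a: its pairing with [M] is N^(p+1), its divergence is tau (n + 2p) N^p. *)
Lemma gexp_linear_image p :
  gexp (fun M => (\sum_a (\sum_i \sum_j c a i j * M i j) ^+ 2) ^+ p) =
  tau ^+ p * \prod_(j < p) (n + 2 * j)%N%:R.
Proof.
rewrite -[LHS]/(gexp (fun M => N M ^+ p)).
elim: p => [|p IH]; first by rewrite big_ord0 expr0 mulr1 gexp_cst.
pose F i j M := \sum_a c a i j * (W a M * N M ^+ p).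
pose dN i j M := \sum_a 2 * W a M * c a i j.
pose F' i j M := \sum_a c a i j *
  (c a i j * N M ^+ p + W a M * (p%:R * N M ^+ p.-1 * dN i j M)).
have tdN i j : tame (dN i j).
  by apply: tame_sum => a; apply: tameM; [apply: tameM => //|]; exact: tame_cst.
have tF i j : tame (F i j).
  by apply: tame_sum => a; apply: tameM; [exact: tame_cst|apply: tameM => //; exact: tameX].
have tF' i j : tame (F' i j).
  apply: tame_sum => a; apply: tameM; first exact: tame_cst.
  apply: tameD; first by apply: tameM; [exact: tame_cst|exact: tameX].
  apply: tameM => //; apply: tameM => //; apply: tameM; [exact: tame_cst|exact: tameX].
have dF i j M x : is_derive x (1 : R) (fun x => F i j (set_entry i j M x))
    (F' i j (set_entry i j M x)).
  apply: is_derive_sumf => a.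
  have dNx : is_derive x (1 : R) (fun x => N (set_entry i j M x)) (dN i j (set_entry i j M x)).
    apply: is_derive_sumf => b; have h := is_derive_expf 2 (dW b i j M x).
    by apply: (is_derive_eq h); rewrite expr1.
  have h := is_derive_mulf (is_derive_cst (c a i j) x (1 : R))
    (is_derive_mulf (dW a i j M x) (is_derive_expf p dNx)).
  by apply: (is_derive_eq h); rewrite mul0r add0r.
have := gexp_divergence tF tF' dF.
have -> : (fun M : 'M[R]_(l, m) => \sum_i \sum_j M i j * F i j M) = (fun M : 'M[R]_(l, m) => N M ^+ p.+1).
  apply/funext => M.
  have -> : N M ^+ p.+1 = \sum_a W a M * (W a M * N M ^+ p).
    by rewrite exprS {1}/N mulr_suml; apply: eq_bigr => a _; rewrite expr2 mulrA.
  under eq_bigr do under eq_bigr do rewrite /F mulr_sumr.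
  under eq_bigr do rewrite exchange_big /=.
  rewrite exchange_big /=; apply: eq_bigr => a _.
  move: (W a M * N M ^+ p) => Z; rewrite /W mulr_suml; apply: eq_bigr => i _; rewrite mulr_suml; apply: eq_bigr => j _.
  by rewrite mulrA [M i j * _]mulrC.
move=> ->.
have -> : (fun M : 'M[R]_(l, m) => \sum_i \sum_j F' i j M) =
    (fun M : 'M[R]_(l, m) => tau * (n + 2 * p)%N%:R * N M ^+ p).
  apply/funext => M.
  have orthW a : \sum_i \sum_j c a i j * dN i j M = 2 * tau * W a M.
    under eq_bigr do under eq_bigr do rewrite /dN mulr_sumr.
    under eq_bigr do rewrite exchange_big /=.
    rewrite exchange_big /=.
    transitivity (\sum_b 2 * W b M * (tau *+ (a == b))).
      apply: eq_bigr => b _; move: (W b M) => Z.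
      rewrite -orth mulr_sumr; apply: eq_bigr => i _.
      by rewrite mulr_sumr; apply: eq_bigr => j _; ring.
    rewrite (bigD1 a)//= big1 => [|b ba]; last by rewrite eq_sym (negbTE ba) mulr0.
    by rewrite eqxx addr0 mulr1n; ring.
  transitivity (\sum_a (tau * N M ^+ p + p%:R * N M ^+ p.-1 * W a M * (2 * tau * W a M))).
    under eq_bigr do rewrite exchange_big /=.
    rewrite exchange_big /=; apply: eq_bigr => a _.
    have aa := orth a a; rewrite eqxx mulr1n in aa.
    rewrite -orthW -{1}aa.
    move: (N M ^+ p) (N M ^+ p.-1) (W a M) => Z Z' Z''.
    rewrite mulr_suml mulr_sumr -big_split /=.
    apply: eq_bigr => i _; rewrite mulr_suml mulr_sumr -big_split /=.
    by apply: eq_bigr => j _; ring.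
  rewrite big_split /= sumr_const card_ord.
  have -> : \sum_a p%:R * N M ^+ p.-1 * W a M * (2 * tau * W a M) =
      2 * tau * (p%:R * (N M ^+ p.-1 * N M)).
    move: (N M ^+ p.-1) => Z.
    by rewrite /N !mulr_sumr; apply: eq_bigr => a _; move: (W a M) => Z'; ring.
  (* At p = 0 the exponent [p.-1] is 0 and the factor [p%:R] makes both sides vanish. *)
  have -> : p%:R * (N M ^+ p.-1 * N M) = p%:R * N M ^+ p.
    by case: p {IH F F' tF tF' dF} => [|p]; rewrite ?mul0r//= -exprSr.
  by rewrite -mulr_natr natrD natrM; ring.
rewrite gexpZ; last exact: tameX.
by rewrite IH big_ord_recr /= exprS; ring.
Qed.

End linear_image.
End gaussian_expectation.

(** * The resolvent of the Gram matrix *)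

Section regularized_gram.
Context {R : realType} (l n : nat).
Implicit Types (G : 'M[R]_(l, n)) (x z : 'cV[R]_n) (e : R).

Definition reg_gram G e : 'M[R]_n := G^T *m G + e%:M.

Lemma reg_gram_sym G e : (reg_gram G e)^T = reg_gram G e.
Proof. by rewrite /reg_gram linearD /= trmx_mul trmxK tr_scalar_mx. Qed.

Lemma reg_gram_form G e x z :
  (x^T *m reg_gram G e *m z) 0 0 = ((G *m x)^T *m (G *m z)) 0 0 + e * (x^T *m z) 0 0.
Proof.
rewrite /reg_gram mulmxDr mulmxDl mxE trmx_mul !mulmxA; congr (_ + _).
by rewrite mul_mx_scalar -scalemxAl mxE.
Qed.

Lemma reg_gram_quad G e x :
  (x^T *m reg_gram G e *m x) 0 0 = vnorm (G *m x) ^+ 2 + e * vnorm x ^+ 2.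
Proof. by rewrite reg_gram_form -!sqr_vnormE. Qed.

Let trmxZ p q (c : R) (M : 'M[R]_(p, q)) : (c *: M)^T = c *: M^T.
Proof. by apply/matrixP => i j; rewrite !mxE. Qed.

Variable e : R.
Hypothesis e0 : 0 < e.

Lemma reg_gram_unit G : reg_gram G e \in unitmx.
Proof.
apply: inj_unitmx => x Kx; apply: vnorm0_eq0; apply/eqP.
have := reg_gram_quad G e x; rewrite -mulmxA Kx mulmx0 mxE => Q0.
have h1 := sqr_ge0 (vnorm (G *m x)).
have h2 := mulr_ge0 (ltW e0) (sqr_ge0 (vnorm x)).
have /eqP : e * vnorm x ^+ 2 = 0 by lra.
by rewrite mulf_eq0 (gt_eqF e0) sqrf_eq0.
Qed.

Definition resolvent G := invmx (reg_gram G e).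

Lemma resolvent_sym G : (resolvent G)^T = resolvent G.
Proof. by rewrite /resolvent trmx_inv reg_gram_sym. Qed.

Lemma resolvent_quad G x :
  (x^T *m resolvent G *m x) 0 0 =
  vnorm (G *m (resolvent G *m x)) ^+ 2 + e * vnorm (resolvent G *m x) ^+ 2.
Proof.
rewrite -reg_gram_quad trmx_mul resolvent_sym -!mulmxA; congr ((_ *m (_ *m _)) _ _).
by rewrite mulKVmx// reg_gram_unit.
Qed.

Lemma resolvent_quad_ge0 G x : 0 <= (x^T *m resolvent G *m x) 0 0.
Proof. by rewrite resolvent_quad addr_ge0 ?sqr_ge0// mulr_ge0 ?sqr_ge0// ltW. Qed.

(** With b = R x, e |b|^2 <= <x, b> <= |x| |b|. Uniformity in [G] is what makes the resolvent tame
    and its derivative accessible. *)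
Lemma vnorm_resolvent G x : e * vnorm (resolvent G *m x) <= vnorm x.
Proof.
set b := resolvent G *m x.
have [->|b0] := eqVneq b 0; first by rewrite vnorm0 mulr0 vnorm_ge0.
have nb := vnorm_gt0 b0.
rewrite -(ler_pM2r nb) -mulrA -expr2.
apply: (@le_trans _ _ ((x^T *m b) 0 0)).
  by rewrite /b mulmxA resolvent_quad -/b lerDr sqr_ge0.
apply: le_trans (ler_norm _) _.
rewrite -(@ler_pXn2r _ 2) ?nnegrE ?mulr_ge0 ?vnorm_ge0//.
by rewrite real_normK ?num_real// exprMn cauchy_schwarz.
Qed.

Lemma resolvent_entry_le G a b : `|resolvent G a b| <= e^-1.
Proof.
have -> : resolvent G a b = (resolvent G *m (delta_mx b 0 : 'cV[R]_n)) a 0.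
  by rewrite -colE mxE.
set v := resolvent G *m _.
have vle : vnorm v <= e^-1.
  rewrite -(ler_pM2l e0) divff ?gt_eqF//; apply: le_trans (vnorm_resolvent _ _) _.
  have d2 := sqr_vnorm (delta_mx b 0 : 'cV[R]_n).
  suff -> : vnorm (delta_mx b 0 : 'cV[R]_n) = 1 by [].
  rewrite /vnorm (bigD1 b)//= big1 => [|j jb]; last by rewrite mxE (negbTE jb) expr0n.
  by rewrite mxE !eqxx expr1n addr0 sqrtr1.
apply: le_trans vle.
rewrite -(@ler_pXn2r _ 2) ?nnegrE ?vnorm_ge0// sqr_vnorm real_normK ?num_real//.
by rewrite (bigD1 a)//= lerDl sumr_ge0// => i _; exact: sqr_ge0.
Qed.

(** With b = R x, the product x^T z is the value of the form G^T G + e at (b, z). Stacking [G *m v]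
    over [Num.sqrt e *: v] makes this form Euclidean. *)
Lemma resolvent_cauchy_schwarz G x z :
  ((x^T *m z) 0 0) ^+ 2 <=
  (x^T *m resolvent G *m x) 0 0 * (vnorm (G *m z) ^+ 2 + e * vnorm z ^+ 2).
Proof.
rewrite resolvent_quad; set b := resolvent G *m x.
have -> : x^T *m z = b^T *m reg_gram G e *m z.
  by rewrite /b trmx_mul resolvent_sym mulmxKV// reg_gram_unit.
rewrite reg_gram_form.
have sq (v : 'cV[R]_n) : vnorm (G *m v) ^+ 2 + e * vnorm v ^+ 2 =
    vnorm (col_mx (G *m v) (Num.sqrt e *: v)) ^+ 2.
  rewrite !sqr_vnormE tr_col_mx mul_row_col [RHS]mxE; congr (_ + _).
  rewrite trmxZ -scalemxAl -scalemxAr scalerA [RHS]mxE -expr2 sqr_sqrtr//.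
  exact: ltW.
rewrite !sq.
have -> : ((G *m b)^T *m (G *m z)) 0 0 + e * (b^T *m z) 0 0 =
   ((col_mx (G *m b) (Num.sqrt e *: b))^T *m col_mx (G *m z) (Num.sqrt e *: z)) 0 0.
  rewrite tr_col_mx mul_row_col [RHS]mxE; congr (_ + _).
  rewrite trmxZ -scalemxAl -scalemxAr scalerA [RHS]mxE -expr2 sqr_sqrtr//.
  exact: ltW.
exact: cauchy_schwarz.
Qed.

Lemma vnorm_gram_resolvent_le G x :
  vnorm (G *m (resolvent G *m x)) ^+ 2 <= (x^T *m resolvent G *m x) 0 0.
Proof. by rewrite resolvent_quad lerDl mulr_ge0 ?sqr_ge0// ltW. Qed.

(** By cyclicity this is the trace of (K - e) K^-1 = 1 - e K^-1 with K the regularized Gram matrix,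
    and the diagonal of K^-1 is nonnegative. *)
Lemma mxtrace_gram_resolvent_le G : \tr (G *m resolvent G *m G^T) <= n%:R.
Proof.
rewrite mxtrace_mulC mulmxA.
have -> : G^T *m G = reg_gram G e - e%:M by rewrite addrK.
rewrite mulmxBl mulmxV ?reg_gram_unit// linearB /= mxtrace1 gerBl.
rewrite mul_scalar_mx linearZ /= mulr_ge0 ?(ltW e0)//.
rewrite /mxtrace sumr_ge0// => i _.
have := resolvent_quad_ge0 G (delta_mx i 0); rewrite trmx_delta -rowE -colE.
by rewrite !mxE.
Qed.

Lemma gram_resolvent_form G x :
  ((G *m (resolvent G *m x))^T *m (G *m x)) 0 0 =
  vnorm x ^+ 2 - e * (x^T *m resolvent G *m x) 0 0.
Proof.
have := reg_gram_form G e (resolvent G *m x) x.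
rewrite trmx_mul resolvent_sym mulmxKV ?reg_gram_unit// -sqr_vnormE => ->.
by rewrite addrK.
Qed.

End regularized_gram.

(** * Measurability and derivative of the inverse matrix *)

Section measurable_inverse.
Context {R : realType} d (T : measurableType d).

(** Written as f (f^2)^(-1), so that the real power acts on a nonnegative base; the factor [f w]
    gives 0 where [f] vanishes, in accord with [0^-1 = 0]. *)
Lemma measurable_invr (f : T -> R) : measurable_fun setT f ->
  measurable_fun setT (fun w => (f w)^-1).
Proof.
move=> mf; rewrite (_ : (fun w => _) = (fun w => f w * (f w ^+ 2) `^ (-1))).
  apply: measurable_funM => //.
  by apply: (measurableT_comp (measurable_powR (-1))); exact: measurable_funX.
apply/funext => w; rewrite powR_inv1 ?sqr_ge0//.
have [->|f0] := eqVneq (f w) 0; first by rewrite invr0 mul0r.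
by field.
Qed.

Lemma measurable_det n (M : T -> 'M[R]_n) : measurable_mx M ->
  measurable_fun setT (fun w => \det (M w)).
Proof.
move=> mM; apply: measurable_sum => s; apply: measurable_funM => //.
by apply: measurable_prod => i _; exact: mM.
Qed.

Lemma measurable_invmx n (M : T -> 'M[R]_n) : measurable_mx M ->
  (forall w, M w \in unitmx) -> measurable_mx (fun w => invmx (M w)).
Proof.
move=> mM uM i j.
rewrite (_ : (fun w => _) = (fun w => (\det (M w))^-1 * cofactor (M w) j i)).
  apply: measurable_funM; first by apply: measurable_invr; exact: measurable_det.
  apply: measurable_funM => //; apply: measurable_det => a b.
  by under eq_fun do rewrite !mxE; exact: mM.
by apply/funext => w; rewrite /invmx uM !mxE.
Qed.

End measurable_inverse.

Section derivative_inverse.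
Context {R : realType} (n : nat).
Variables (K : R -> 'M[R]_n) (K' : 'M[R]_n) (C : R) (x : R).
Hypothesis uK : forall t, K t \in unitmx.
Hypothesis boundK : forall t a b, `|invmx (K t) a b| <= C.
Hypothesis dK : forall a b, is_derive x (1 : R) (fun t => K t a b) (K' a b).

(** The resolvent identity. The moving inverse appears on the right only next to the increment of
    [K], so the uniform bound [C] gives continuity, and continuity gives the derivative after
    division by the increment. *)
Let invmxB t : invmx (K t) = invmx (K x) - invmx (K t) *m (K t - K x) *m invmx (K x).
Proof.
rewrite mulmxBr mulVmx// mulmxBl mul1mx -mulmxA mulmxV// mulmx1.
by rewrite opprB addrC subrK.
Qed.

Let entryE t a b : invmx (K t) a b = invmx (K x) a b -
  \sum_f \sum_g invmx (K t) a g * (K t g f - K x g f) * invmx (K x) f b.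
Proof.
rewrite {1}invmxB !mxE; congr (_ - _); apply: eq_bigr => f _.
rewrite mxE mulr_suml; apply: eq_bigr => g _.
by rewrite !mxE.
Qed.

Lemma continuous_invmx a b : {for x, continuous (fun t => invmx (K t) a b)}.
Proof.
have cK g f : K t g f @[t --> x] --> K x g f.
  by apply: differentiable_continuous; apply/derivable1_diffP; case: (dK g f).
have C0 : 0 <= C by apply: le_trans (boundK x a b); exact: normr_ge0.
pose S t := \sum_f \sum_g invmx (K t) a g * (K t g f - K x g f) * invmx (K x) f b.
have cS : S t @[t --> x] --> 0.
  apply: norm_cvg0.
  apply: (@squeeze_cvgr _ _ _ _ (fun=> 0)
      (fun t => \sum_f \sum_g C * `|K t g f - K x g f| * C)).
  - apply: nearW => t; rewrite normr_ge0/=.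
    apply: le_trans (ler_norm_sum _ _ _) _; apply: ler_sum => f _.
    apply: le_trans (ler_norm_sum _ _ _) _; apply: ler_sum => g _.
    by rewrite !normrM; apply: ler_pM => //; rewrite ?mulr_ge0//; apply: ler_pM.
  - exact: cvg_cst.
  - have e0 : \sum_(f < n) \sum_(g < n) C * `|K x g f - K x g f| * C = 0.
      by rewrite big1// => f _; rewrite big1// => g _; rewrite subrr normr0 mulr0 mul0r.
    rewrite -[X in _ --> X]e0.
    have hN f g : C * `|K t g f - K x g f| * C @[t --> x] --> C * `|K x g f - K x g f| * C.
      have hN : `|K t g f - K x g f| @[t --> x] --> `|K x g f - K x g f|.
        by apply: cvg_norm; apply: cvgB; [exact: cK|exact: cvg_cst].
      exact: (cvgM (cvgM (cvg_cst C) hN) (cvg_cst C)).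
    have hS f := @cvg_bigsum R R (nbhs x) (nbhs_filter x) _ (index_enum 'I_n) _ _ (hN f).
    exact: (@cvg_bigsum R R (nbhs x) (nbhs_filter x) _ (index_enum 'I_n) _ _ hS).
have h : invmx (K x) a b - S t @[t --> x] --> invmx (K x) a b - 0.
  by apply: cvgB => //; exact: cvg_cst.
rewrite subr0 in h.
by rewrite /prop_for /continuous_at; under eq_fun do rewrite entryE.
Qed.

Lemma is_derive_invmx a b : is_derive x (1 : R) (fun t => invmx (K t) a b)
  (- (invmx (K x) *m K' *m invmx (K x)) a b).
Proof.
pose D (h : R) : R := h^-1 *: (invmx (K (h *: (1 : R) + x)) a b - invmx (K x) a b).
suff cD : D h @[h --> 0^'] --> - (invmx (K x) *m K' *m invmx (K x)) a b.
  apply: DeriveDef; first by apply/cvg_ex; exists (- (invmx (K x) *m K' *m invmx (K x)) a b).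
  exact: cvg_lim cD.
have DE (h : R) : D h = - \sum_f \sum_g invmx (K (h *: (1 : R) + x)) a g *
    (h^-1 *: (K (h *: (1 : R) + x) g f - K x g f)) * invmx (K x) f b.
  rewrite /D entryE addrAC subrr add0r scalerN; congr (- _).
  rewrite scaler_sumr; apply: eq_bigr => f _; rewrite scaler_sumr; apply: eq_bigr => g _.
  by rewrite /GRing.scale /=; ring.
under eq_fun do rewrite DE.
apply: cvgN.
have -> : (invmx (K x) *m K' *m invmx (K x)) a b =
    \sum_f \sum_g invmx (K x) a g * K' g f * invmx (K x) f b.
  rewrite mxE; apply: eq_bigr => f _; rewrite mxE mulr_suml.
  by apply: eq_bigr => g _.
have h1 : h *: (1 : R) + x @[h --> (0 : R)^'] --> x.
  rewrite -[X in _ --> X]add0r; apply: cvgD; last exact: cvg_cst.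
  rewrite -[X in _ --> X](scale0r (1 : R)).
  apply: cvgZr_tmp; exact: cvg_within.
have hT f g : invmx (K (h *: (1 : R) + x)) a g *
    (h^-1 *: (K (h *: (1 : R) + x) g f - K x g f)) * invmx (K x) f b @[h --> (0 : R)^'] -->
    invmx (K x) a g * K' g f * invmx (K x) f b.
  have hR := cvg_comp _ _ h1 (@continuous_invmx a g).
  have hd : h^-1 *: (K (h *: (1 : R) + x) g f - K x g f) @[h --> (0 : R)^'] --> K' g f.
    by have [dv <-] := dK g f; exact: dv.
  exact: (cvgM (cvgM hR hd) (cvg_cst _)).
have hS f := @cvg_bigsum R R ((0 : R)^') (dnbhs_filter (0 : R)) _ (index_enum 'I_n) _ _ (hT f).
exact: (@cvg_bigsum R R ((0 : R)^') (dnbhs_filter (0 : R)) _ (index_enum 'I_n) _ _ hS).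
Qed.

End derivative_inverse.

Section matrix_derivatives.
Context {R : realType}.

Definition is_derive_mx p q (x : R) (A : R -> 'M[R]_(p, q)) (A' : 'M[R]_(p, q)) :=
  forall a b, is_derive x (1 : R) (fun t => A t a b) (A' a b).

Lemma is_derive_mx_cst p q x (A : 'M[R]_(p, q)) : is_derive_mx x (fun=> A) 0.
Proof. by move=> a b; rewrite mxE; exact: is_derive_cst. Qed.

Lemma is_derive_mxD p q x (A B : R -> 'M[R]_(p, q)) A' B' :
  is_derive_mx x A A' -> is_derive_mx x B B' ->
  is_derive_mx x (fun t => A t + B t) (A' + B').
Proof.
move=> dA dB a b; under eq_fun do rewrite mxE.
by rewrite mxE; exact: is_derive_addf.
Qed.

Lemma is_derive_mxM p q r x (A : R -> 'M[R]_(p, q)) (B : R -> 'M[R]_(q, r)) A' B' :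
  is_derive_mx x A A' -> is_derive_mx x B B' ->
  is_derive_mx x (fun t => A t *m B t) (A' *m B x + A x *m B').
Proof.
move=> dA dB a b; under eq_fun do rewrite mxE.
rewrite !mxE -big_split /=.
by apply: is_derive_sumf => k; exact: is_derive_mulf.
Qed.

Lemma is_derive_trmx p q x (A : R -> 'M[R]_(p, q)) A' :
  is_derive_mx x A A' -> is_derive_mx x (fun t => (A t)^T) A'^T.
Proof. by move=> dA a b; under eq_fun do rewrite mxE; rewrite mxE. Qed.

Lemma is_derive_set_entry l m (i : 'I_l) (j : 'I_m) (M : 'M[R]_(l, m)) x :
  is_derive_mx x (set_entry i j M) (delta_mx i j).
Proof.
move=> a b; under eq_fun do rewrite mxE; rewrite mxE.
by case: (_ && _); [exact: is_derive_id|exact: is_derive_cst].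
Qed.

End matrix_derivatives.

Lemma mul_delta_mx_entry (R : realType) p q r t (X : 'M[R]_(p, r)) (V : 'M[R]_(t, q))
    j i a b :
  (X *m delta_mx j i *m V) a b = X a j * V i b.
Proof.
rewrite mxE (bigD1 i)//= big1 => [|k ki].
  rewrite addr0; congr (_ * _); rewrite mxE (bigD1 j)//= big1 => [|k kj].
    by rewrite addr0 mxE !eqxx mulr1.
  by rewrite mxE (negbTE kj) mulr0.
rewrite mxE big1 ?mul0r// => h _.
by rewrite mxE (negbTE ki) andbF mulr0.
Qed.

Section tame_matrices.
Context {R : realType} (l m : nat).

Definition tame_mx p q (A : 'M[R]_(l, m) -> 'M[R]_(p, q)) :=
  forall a b, tame (fun M => A M a b).

Lemma tame_mx_cst p q (A : 'M[R]_(p, q)) : tame_mx (fun=> A).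
Proof. by move=> a b; exact: tame_cst. Qed.

Lemma tame_mx_id : tame_mx id.
Proof. by move=> a b; exact: tame_entry. Qed.

Lemma tame_trmx p q (A : 'M[R]_(l, m) -> 'M[R]_(p, q)) :
  tame_mx A -> tame_mx (fun M => (A M)^T).
Proof. by move=> tA a b; under eq_fun do rewrite mxE; exact: tA. Qed.

Lemma tame_mulmx p q r (A : 'M[R]_(l, m) -> 'M[R]_(p, q))
    (B : 'M[R]_(l, m) -> 'M[R]_(q, r)) :
  tame_mx A -> tame_mx B -> tame_mx (fun M => A M *m B M).
Proof.
move=> tA tB a b; under eq_fun do rewrite mxE.
by apply: tame_sum => k; exact: tameM.
Qed.

End tame_matrices.

Section resolvent_moments.
Context {R : realType} (l m n : nat) (Q : 'M[R]_(m, n)) (e : R).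
Hypothesis e0 : 0 < e.
Local Notation mat := (g_sigma_algebraType (@rectangles R l m)).
Local Notation Rv M := (resolvent e (M *m Q)).

Let dgram (i : 'I_l) (j : 'I_m) (M : 'M[R]_(l, m)) (t : R) : 'M[R]_n :=
  (delta_mx i j *m Q)^T *m (set_entry i j M t *m Q) +
  (set_entry i j M t *m Q)^T *m (delta_mx i j *m Q).

Lemma is_derive_reg_gram i j M x :
  is_derive_mx x (fun t => reg_gram (set_entry i j M t *m Q) e) (dgram i j M x).
Proof.
have dG : is_derive_mx x (fun t => set_entry i j M t *m Q) (delta_mx i j *m Q).
  have := is_derive_mxM (is_derive_set_entry i j M x) (is_derive_mx_cst x Q).
  by rewrite mulmx0 addr0.
have := is_derive_mxD (is_derive_mxM (is_derive_trmx dG) dG) (is_derive_mx_cst x e%:M).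
by rewrite addr0.
Qed.

Lemma is_derive_resolvent i j M x :
  is_derive_mx x (fun t => Rv (set_entry i j M t))
    (- (Rv (set_entry i j M x) *m dgram i j M x *m Rv (set_entry i j M x))).
Proof.
move=> a b; rewrite mxE; apply: (@is_derive_invmx _ _ _ _ e^-1).
- by move=> t; exact: reg_gram_unit.
- by move=> t c d; exact: resolvent_entry_le.
- by move=> c d; exact: is_derive_reg_gram.
Qed.

Lemma tame_resolvent : tame_mx (fun M : 'M[R]_(l, m) => Rv M).
Proof.
move=> a b; split.
- have mG : measurable_mx (fun M : mat => (M : 'M[R]_(l, m)) *m Q).
    by apply: measurable_mulmx; [exact: measurable_mat_entry|exact: measurable_mx_cst].
  apply: (@measurable_invmx _ _ mat _ (fun M => reg_gram (M *m Q) e)) => [c d|M].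
    under eq_fun do rewrite /reg_gram mxE; apply: measurable_funD.
      by apply: measurable_mulmx => //; exact: measurable_trmx.
    exact: measurable_cst.
  exact: reg_gram_unit.
- exists (e^-1, 0%N) => /=; first by rewrite invr_ge0 ltW.
  by move=> M; rewrite expr0 mulr1; exact: resolvent_entry_le.
- move=> i j M x; apply: differentiable_continuous; apply/derivable1_diffP.
  by case: (is_derive_resolvent i j M x a b).
Qed.

End resolvent_moments.

(** * Inverse moments of the Gram matrix *)

Section inverse_moments.
Context {R : realType} d (T : measurableType d) (P : probability T R) (l m n : nat).
Variable Om : T -> 'M[R]_(l, m).
Hypothesis gOm : gaussian_matrix P Om.
Variables (Q : 'M[R]_(m, n)) (e : R) (xi : 'cV[R]_n).
Hypotheses (QQ : Q^T *m Q = 1%:M) (e0 : 0 < e).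
Implicit Types (M : 'M[R]_(l, m)) (i : 'I_l) (j : 'I_m).

Let Rv M := resolvent e (M *m Q).
Let b M : 'cV[R]_n := Rv M *m xi.
Let a M : 'cV[R]_l := M *m Q *m b M.
Let y M : R := (xi^T *m b M) 0 0.
Let B M : 'M[R]_(l, m) := M *m Q *m Rv M *m Q^T.
Let C M : 'M[R]_l := M *m Q *m Rv M *m (M *m Q)^T.

Let tameRv : tame_mx Rv. Proof. exact: tame_resolvent. Qed.

Let tameMQ : tame_mx (fun M => M *m Q).
Proof. by apply: tame_mulmx; [exact: tame_mx_id|exact: tame_mx_cst]. Qed.

Let tameb : tame_mx b.
Proof. by apply: tame_mulmx => //; exact: tame_mx_cst. Qed.

Let tamea : tame_mx a. Proof. exact: tame_mulmx. Qed.

Let tamey : tame y.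
Proof.
rewrite /y; have h := tame_mulmx (tame_mx_cst l m xi^T) tameb.
exact: (h 0 0).
Qed.

Let tame_B : tame_mx B.
Proof. by apply: tame_mulmx; [exact: tame_mulmx|exact: tame_mx_cst]. Qed.

Let tame_C : tame_mx C.
Proof. by apply: tame_mulmx; [exact: tame_mulmx|exact: tame_trmx]. Qed.

Let Qb M := Q *m b M.

Let tameQb : tame_mx Qb.
Proof. by apply: tame_mulmx => //; exact: tame_mx_cst. Qed.

Let y_ge0 M : 0 <= y M.
Proof. by rewrite /y /b mulmxA; exact: resolvent_quad_ge0. Qed.

Let Rv_sym M : (Rv M)^T = Rv M. Proof. exact: resolvent_sym. Qed.

(** Derivatives in entry (i, j) of the i-th entry of [a], and below of [y]. The two corrections in
    [da] come from the two occurrences of [M] in the Gram matrix. *)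
Let da i j M : R := Qb M j 0 - B M i j * a M i 0 - C M i i * Qb M j 0.
Let dy i j M : R := - (2 * a M i 0 * Qb M j 0).

Let is_derive_b i j M x : is_derive_mx x (fun t => b (set_entry i j M t))
  (- (let M := set_entry i j M x in
    Rv M *m Q^T *m delta_mx j i *m a M + Rv M *m (M *m Q)^T *m delta_mx i j *m Qb M)).
Proof.
have := is_derive_mxM (is_derive_resolvent Q e0 i j M x) (is_derive_mx_cst x xi).
rewrite mulmx0 addr0 mulNmx /=; set M' := set_entry i j M x.
rewrite -[resolvent e _]/(Rv M') mulmxDr !mulmxDl trmx_mul trmx_delta.
by rewrite /a /Qb /b !mulmxA.
Qed.

Let is_derive_a i j M x :
  is_derive x (1 : R) (fun t => a (set_entry i j M t) i 0) (da i j (set_entry i j M x)).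
Proof.
have dG : is_derive_mx x (fun t => set_entry i j M t *m Q) (delta_mx i j *m Q).
  have := is_derive_mxM (is_derive_set_entry i j M x) (is_derive_mx_cst x Q).
  by rewrite mulmx0 addr0.
have h := is_derive_mxM dG (is_derive_b i j M x).
apply: (is_derive_eq (h i 0)); rewrite /=; set M' := set_entry i j M x.
rewrite mulmxN mulmxDr /da.
have e1 : (delta_mx i j *m Q *m b M') i 0 = Qb M' j 0.
  by rewrite -[delta_mx i j]mul1mx -mulmxA mul_delta_mx_entry mxE eqxx mul1r.
have e2 : M' *m Q *m (Rv M' *m Q^T *m delta_mx j i *m a M') =
    B M' *m delta_mx j i *m a M' by rewrite /B !mulmxA.
have e3 : M' *m Q *m (Rv M' *m (M' *m Q)^T *m delta_mx i j *m Qb M') =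
    C M' *m delta_mx i j *m Qb M' by rewrite /C !mulmxA.
rewrite e2 e3 [LHS]mxE e1 -addrA; congr (_ + _).
by rewrite mxE [X in - X]mxE !mul_delta_mx_entry opprD.
Qed.

Let is_derive_y i j M x :
  is_derive x (1 : R) (fun t => y (set_entry i j M t)) (dy i j (set_entry i j M x)).
Proof.
have h := is_derive_mxM (is_derive_mx_cst x xi^T) (is_derive_b i j M x).
apply: (is_derive_eq (h 0 0)); rewrite /=; set M' := set_entry i j M x.
rewrite mul0mx add0r mulmxN mulmxDr /dy.
have QbT : (Qb M')^T = xi^T *m Rv M' *m Q^T by rewrite /Qb /b !trmx_mul Rv_sym.
have aT : (a M')^T = xi^T *m Rv M' *m (M' *m Q)^T.
  by rewrite /a /b [LHS]trmx_mul [X in X *m _]trmx_mul Rv_sym.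
have e1 : xi^T *m (Rv M' *m Q^T *m delta_mx j i *m a M') =
    (Qb M')^T *m delta_mx j i *m a M'.
  by rewrite QbT !mulmxA.
have e2 : xi^T *m (Rv M' *m (M' *m Q)^T *m delta_mx i j *m Qb M') =
    (a M')^T *m delta_mx i j *m Qb M'.
  by rewrite aT !mulmxA.
rewrite e1 e2 [LHS]mxE; congr (- _); rewrite [LHS]mxE !mul_delta_mx_entry.
by rewrite [(Qb M')^T 0 j]mxE [(a M')^T 0 i]mxE; ring.
Qed.

(* The vector field whose divergence yields the recursion for the moments of [y]. *)
Let F p i j M := a M i 0 * (Q *m xi) j 0 * y M ^+ p.
Let F' p i j M := (Q *m xi) j 0 *
  (da i j M * y M ^+ p + a M i 0 * (p%:R * y M ^+ p.-1 * dy i j M)).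

Let tameda i j : tame (da i j).
Proof.
apply: tameB; last by apply: tameM; [exact: tame_C|exact: tameQb].
by apply: tameB; [exact: tameQb|apply: tameM; [exact: tame_B|exact: tamea]].
Qed.

Let sumMF p M : \sum_i \sum_j M i j * F p i j M =
  vnorm xi ^+ 2 * y M ^+ p - e * y M ^+ p.+1.
Proof.
transitivity (((a M)^T *m (M *m Q *m xi)) 0 0 * y M ^+ p).
  rewrite mxE mulr_suml; apply: eq_bigr => i _.
  rewrite mxE -mulmxA [(M *m _) i 0]mxE mulr_sumr mulr_suml.
  by apply: eq_bigr => j _; rewrite /F; ring.
have yE : (xi^T *m resolvent e (M *m Q) *m xi) 0 0 = y M by rewrite /y /b mulmxA.
rewrite /a {1}/b gram_resolvent_form// yE [y M ^+ _.+1]exprS; ring.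
Qed.

(** The divergence is (l - tr C) y^(p+1) - (1 + 2p) |a|^2 y^p. The two estimates tr C <= n and |a|^2
    <= y lose only terms carrying the factor [e]. *)
Let sumF' p M : (l%:R - n%:R - 1 - 2 * p%:R) * y M ^+ p.+1 <=
  \sum_i \sum_j F' p i j M.
Proof.
pose S := vnorm (a M) ^+ 2.
have sumQb : \sum_j (Q *m xi) j 0 * Qb M j 0 = y M.
  transitivity (((Q *m xi)^T *m Qb M) 0 0).
    by rewrite mxE; apply: eq_bigr => j _; rewrite [(_ ^T) 0 j]mxE.
  by rewrite /Qb trmx_mul mulmxA -(mulmxA xi^T) QQ mulmx1.
have sumB i : \sum_j (Q *m xi) j 0 * B M i j = a M i 0.
  transitivity ((B M *m (Q *m xi)) i 0).
    by rewrite mxE; apply: eq_bigr => j _; rewrite mulrC.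
  by rewrite /B /a /b -!mulmxA (mulmxA Q^T) QQ mul1mx.
have yp : p%:R * y M ^+ p.-1 * y M = p%:R * y M ^+ p.
  by case: (p) => [|q]; rewrite ?mul0r//= -mulrA -exprSr.
have -> : \sum_i \sum_j F' p i j M = (l%:R - \tr (C M)) * y M ^+ p.+1 -
    (1 + 2 * p%:R) * S * y M ^+ p.
  transitivity (\sum_i (y M ^+ p.+1 - C M i i * y M ^+ p.+1 -
      a M i 0 ^+ 2 * ((1 + 2 * p%:R) * y M ^+ p))).
    apply: eq_bigr => i _.
    transitivity ((\sum_j (Q *m xi) j 0 * Qb M j 0) *
        (y M ^+ p - C M i i * y M ^+ p - 2 * a M i 0 ^+ 2 * (p%:R * y M ^+ p.-1)) -
      (\sum_j (Q *m xi) j 0 * B M i j) * (a M i 0 * y M ^+ p)).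
      rewrite !mulr_suml -sumrB; apply: eq_bigr => j _.
      by rewrite /F' /da /dy; ring.
    rewrite sumQb sumB [y M ^+ p.+1]exprS.
    transitivity (y M * y M ^+ p - C M i i * (y M * y M ^+ p) -
      a M i 0 ^+ 2 * y M ^+ p - 2 * a M i 0 ^+ 2 * (p%:R * y M ^+ p.-1 * y M)); first ring.
    by rewrite yp; ring.
  rewrite !sumrB -!mulr_suml sumr_const card_ord -sqr_vnorm -/S -mulr_natl.
  by rewrite /mxtrace; ring.
have S0 : S <= y M.
  have := vnorm_gram_resolvent_le e0 (M *m Q) xi.
  have yE : (xi^T *m resolvent e (M *m Q) *m xi) 0 0 = y M by rewrite /y /b mulmxA.
  by rewrite yE.
have C0 : \tr (C M) <= n%:R by exact: mxtrace_gram_resolvent_le.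
have y0 := y_ge0 M.
have yp0 : 0 <= y M ^+ p by rewrite exprn_ge0.
have yp1 : 0 <= y M ^+ p.+1 by rewrite exprn_ge0.
have h1 := ler_wpM2r yp1 C0.
have p0 : 0 <= 1 + 2 * p%:R :> R by rewrite addr_ge0// mulr_ge0.
have h2 : (1 + 2 * p%:R) * S * y M ^+ p <= (1 + 2 * p%:R) * y M ^+ p.+1.
  by rewrite -mulrA ler_wpM2l// exprS ler_wpM2r.
lra.
Qed.

Lemma inverse_moment_step p :
  (l%:R - n%:R - 1 - 2 * p%:R) * gexp P Om (fun M => y M ^+ p.+1) <=
  vnorm xi ^+ 2 * gexp P Om (fun M => y M ^+ p).
Proof.
have tF i j : tame (F p i j).
  apply: tameM; last exact: tameX.
  by apply: tameM; [exact: tamea|exact: tame_cst].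
have tdy i j : tame (dy i j).
  apply: tameN; apply: tameM; last exact: tameQb.
  by apply: tameM; [exact: tame_cst|exact: tamea].
have tF' i j : tame (F' p i j).
  apply: tameM; first exact: tame_cst.
  apply: tameD; first by apply: tameM => //; exact: tameX.
  apply: tameM; first exact: tamea.
  by apply: tameM => //; apply: tameM; [exact: tame_cst|exact: tameX].
have dF i j M x : is_derive x (1 : R) (fun t => F p i j (set_entry i j M t))
    (F' p i j (set_entry i j M x)).
  have h := is_derive_mulf (is_derive_mulf (is_derive_a i j M x)
    (is_derive_cst ((Q *m xi) j 0) x (1 : R))) (is_derive_expf p (is_derive_y i j M x)).
  by apply: (is_derive_eq h); rewrite /F' /cst; ring.
have tyX q : tame (fun M => y M ^+ q) by exact: tameX.
rewrite -!(gexpZ gOm)//.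
apply: (@le_trans _ _ (gexp P Om (fun M => \sum_i \sum_j F' p i j M))).
  apply: (le_gexp gOm) => [||M]; last exact: sumF'.
    by apply: tameM => //; exact: tame_cst.
  by apply: tame_sum => i; apply: tame_sum => j.
rewrite -(gexp_divergence gOm tF tF' dF); apply: (le_gexp gOm) => [||M].
- by apply: tame_sum => i; apply: tame_sum => j; apply: tameM => //; exact: tame_entry.
- by apply: tameM => //; exact: tame_cst.
- by rewrite sumMF gerBl mulr_ge0 ?(ltW e0)// exprn_ge0.
Qed.

(** With e = 0, [y] would be |xi|^2 over a chi-squared variable with l - n + 1 degrees of freedom,
    and this an equality. The condition on [p] keeps the natural subtractions exact and all factors
    positive. *)
Lemma inverse_moment p : (2 * p < l - n)%N ->
  gexp P Om (fun M => y M ^+ p) * \prod_(j < p) (l - n - 1 - 2 * j)%N%:R <=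
  vnorm xi ^+ (2 * p).
Proof.
elim: p => [|p IH] pk.
  by rewrite big_ord0 mulr1 expr0 (gexp_cst P Om 1).
rewrite big_ord_recr /= mulrCA mulrC.
have pk' : (2 * p < l - n)%N by lia.
have := IH pk'; set pr := \prod_(_ < p) _ => {}IH.
have pr0 : 0 <= pr by apply: prodr_ge0.
have := inverse_moment_step p.
have -> : l%:R - n%:R - 1 - 2 * p%:R = (l - n - 1 - 2 * p)%N%:R :> R.
  have : l%:R = (n + 1 + 2 * p + (l - n - 1 - 2 * p))%N%:R :> R.
    by congr _%:R; lia.
  by rewrite [(_ + _)%N%:R]natrD [(_ + _)%N%:R in RHS]natrD => ->; rewrite natrD natrM; ring.
move=> h; have := ler_wpM2r pr0 h.
have := ler_wpM2l (sqr_ge0 (vnorm xi)) IH.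
rewrite -exprD -[(2 + 2 * p)%N]mulnS.
lra.
Qed.

End inverse_moments.

(** * Stirling-type lower bounds for products in steps of two *)

Section stirling.
Context {R : realType}.
Implicit Types (u x y : R) (k p q : nat).

(** For the primitive h(x) = x ln x - x of ln, h(x(1 + u)) - h(x(1 - u)) = 2xu ln x + x(K u - 2u).
    The bound K u <= 2u yields the midpoint rule, and K u >= 2u ln 2 the estimate of the combined
    product. *)
Let K u := (1 + u) * ln (1 + u) - (1 - u) * ln (1 - u).

Let is_derive_K u : -1 < u < 1 ->
  is_derive u (1 : R) K (2 + ln (1 + u) + ln (1 - u)).
Proof.
move=> /andP[u0 u1].
have d1 : is_derive u (1 : R) (fun u : R => 1 + u) 1.
  by have := is_deriveD (is_derive_cst (1 : R) u (1 : R)) (is_derive_id u (1 : R)); rewrite add0r.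
have d2 : is_derive u (1 : R) (fun u : R => 1 - u) (-1).
  by have := is_deriveB (is_derive_cst (1 : R) u (1 : R)) (is_derive_id u (1 : R)); rewrite add0r.
have p1 : 0 < 1 + u by lra.
have p2 : 0 < 1 - u by lra.
have l1 : is_derive u (1 : R) (fun u : R => ln (1 + u)) (1 + u)^-1.
  by have := @is_derive1_comp R (@ln R) (fun u : R => 1 + u) u _ _ (is_derive1_ln p1) d1; rewrite mulr1.
have l2 : is_derive u (1 : R) (fun u : R => ln (1 - u)) (- (1 - u)^-1).
  by have := @is_derive1_comp R (@ln R) (fun u : R => 1 - u) u _ _ (is_derive1_ln p2) d2; rewrite mulrN1.
apply: is_derive_eq.
rewrite /GRing.scale /=; field; lra.
Qed.

Let K_mvt u : 0 <= u < 1 ->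
  exists2 c, 0 <= c <= u & K u = (2 + ln (1 - c ^+ 2)) * u.
Proof.
move=> /andP[u0 u1].
have cK : {within `[0, u], continuous K}.
  apply: derivable_within_continuous => x; rewrite in_itv /= => /andP[x0 xu].
  have xb : -1 < x < 1 by lra.
  by have [] := is_derive_K xb.
have dK x : x \in `]0, u[ -> is_derive x (1 : R) K (2 + ln (1 + x) + ln (1 - x)).
  by rewrite in_itv /= => /andP[x0 xu]; apply: is_derive_K; lra.
have [c] := MVT_segment u0 dK cK; rewrite in_itv /= => /andP[c0 cu] Kc.
exists c; first by rewrite c0 cu.
have -> : K u = K u - K 0 by rewrite /K addr0 subr0 subrr subr0.
rewrite Kc subr0 -addrA -lnM ?posrE; [|lra..].
by congr (_ * _); congr (_ + ln _); ring.
Qed.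

Let K_le u : 0 <= u < 1 -> K u <= 2 * u.
Proof.
move=> u01; have [c cu ->] := K_mvt u01.
rewrite ler_wpM2r//; first by lra.
have : ln (1 - c ^+ 2) <= 0 by apply: ln_le0; nra.
lra.
Qed.

Let ln2_le : ln 2 <= (9 / 10 : R).
Proof.
rewrite -ler_expR lnK ?posrE//.
have -> : (9 / 10 : R) = 3%:R * (3 / 10) by lra.
rewrite expRM_natl.
have h : 13 / 10 <= expR (3 / 10) :> R by have := @expR_ge1Dx R (3 / 10); lra.
have : (13 / 10 : R) ^+ 3 <= expR (3 / 10) ^+ 3 by rewrite lerXn2r// nnegrE; lra.
lra.
Qed.

(** On this range 2 + ln(1 - c^2) >= 2 + ln(55/64) >= 2 - 9/55, just above twice the bound 9/10 for
    ln 2. *)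
Let K_ge u : 0 <= u <= 3 / 8 -> 2 * u * ln 2 <= K u.
Proof.
move=> /andP[u0 u1]; have [|c /andP[c0 cu] ->] := @K_mvt u; first by lra.
rewrite mulrAC ler_wpM2r//.
have c2 : c ^+ 2 <= 9 / 64 by nra.
have : (64 / 55)^-1 <= 1 - c ^+ 2 by lra.
rewrite -ler_ln ?posrE; [|lra..].
rewrite lnV ?posrE; last by lra.
have := @le_ln1Dx R (9 / 55).
have -> : 1 + 9 / 55 = 64 / 55 :> R by lra.
have := ln2_le.
lra.
Qed.

Let h x := x * ln x - x.

(* Midpoint rule for the concave function [ln], of which [h] is a primitive. *)
Let midpoint_ln x : 1 <= x -> (h (x + 1) - h (x - 1)) / 2 <= ln x.
Proof.
(* x = 1 stands apart: it would give u = 1, outside the range of [K_le]. There the claim reads ln 2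
   <= 1. *)
rewrite le_eqVlt => /predU1P[<-|x1].
  have := ln2_le; rewrite /h subrr ln1 mul0r.
  have -> : 1 + 1 = 2 :> R by lra.
  lra.
have x0 : 0 < x by lra.
pose u := x^-1.
have u01 : 0 <= u < 1 by rewrite invr_ge0 (ltW x0)/= invf_lt1.
have xu : x * u = 1 by rewrite divff// gt_eqF.
have e1 : x + 1 = x * (1 + u) by rewrite mulrDr xu mulr1.
have e2 : x - 1 = x * (1 - u) by rewrite mulrBr xu mulr1.
have lp : ln (x + 1) = ln x + ln (1 + u) by rewrite e1 lnM ?posrE//; lra.
have lm : ln (x - 1) = ln x + ln (1 - u) by rewrite e2 lnM ?posrE//; lra.
have := K_le u01; rewrite -(@ler_pM2l _ x)// mulrCA xu mulr1.
rewrite /K /h lp lm => H.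
have a1 : x * u * ln (1 + u) = ln (1 + u) by rewrite xu mul1r.
have a2 : x * u * ln (1 - u) = ln (1 - u) by rewrite xu mul1r.
lra.
Qed.

(** Each 2j + 1 is the midpoint of [2j, 2j + 2], so the midpoint bounds telescope. In the next lemma
    the midpoints are k - 1 - 2j. *)
Lemma ln_prod_odd_ge p :
  h (2 * p%:R) / 2 <= ln (\prod_(j < p) (2 * j + 1)%N%:R).
Proof.
elim: p => [|p IH]; first by rewrite big_ord0 ln1 mulr0 /h mul0r subrr mul0r.
rewrite big_ord_recr /= lnM ?posrE; last 2 first.
- by apply: prodr_gt0 => i _; rewrite ltr0n addn1.
- by rewrite ltr0n addn1.
have p1 : 1 <= (2 * p + 1)%N%:R :> R by rewrite ler1n addn1.
have := midpoint_ln p1.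
have -> : (2 * p + 1)%N%:R + 1 = 2 * p.+1%:R :> R by rewrite natrD natrM -natr1; lra.
have -> : (2 * p + 1)%N%:R - 1 = 2 * p%:R :> R by rewrite natrD natrM; lra.
lra.
Qed.

Lemma ln_prod_step2_ge k p : (2 * p < k)%N ->
  (h k%:R - h (k%:R - 2 * p%:R)) / 2 <= ln (\prod_(j < p) (k - 1 - 2 * j)%N%:R).
Proof.
elim: p => [|p IH] pk; first by rewrite big_ord0 ln1 mulr0 subr0 subrr mul0r.
rewrite big_ord_recr /= lnM ?posrE; last 2 first.
- by apply: prodr_gt0 => i _; rewrite ltr0n; have := ltn_ord i; lia.
- by rewrite ltr0n; lia.
have p1 : 1 <= (k - 1 - 2 * p)%N%:R :> R by rewrite ler1n; lia.
have := midpoint_ln p1.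
have -> : (k - 1 - 2 * p)%N%:R = k%:R - 1 - 2 * p%:R :> R.
  rewrite -subnDA natrB; last by lia. rewrite natrD natrM; lra.
have -> : k%:R - 1 - 2 * p%:R + 1 = k%:R - 2 * p%:R :> R by lra.
have -> : k%:R - 1 - 2 * p%:R - 1 = k%:R - 2 * p.+1%:R :> R by rewrite -natr1; lra.
have pk1 : (2 * p < k)%N by lia.
have := IH pk1; lra.
Qed.

Lemma prod_odd_ge p :
  (2 * p%:R * expR (-1)) ^+ p <= \prod_(j < p) (2 * j + 1)%N%:R :> R.
Proof.
case: p => [|p]; first by rewrite expr0 big_ord0.
have p0 : (0 < p.+1%:R :> R) by rewrite ltr0n.
have q0 : 0 < 2 * p.+1%:R * expR (-1) :> R by rewrite !mulr_gt0// expR_gt0.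
rewrite -ler_ln ?posrE ?exprn_gt0//; last first.
  by apply: prodr_gt0 => i _; rewrite ltr0n addn1.
apply: le_trans (ln_prod_odd_ge _).
rewrite lnXn// lnM ?posrE ?expR_gt0 ?mulr_gt0//.
by rewrite expRK /h -mulr_natr; lra.
Qed.

(* Up to the factor [expR (-2 p)] the two products together behave like
   [k ^ (2 p)] as long as [2 p] lies in a window above [k / 2]. *)
Lemma prod_step2_odd_ge k p : (k <= 4 * p)%N -> (32 * p <= 11 * k)%N ->
  (0 < k)%N ->
  (k%:R * expR (-1)) ^+ (2 * p) <=
  \prod_(j < p) ((k - 1 - 2 * j)%N%:R * (2 * j + 1)%N%:R) :> R.
Proof.
move=> k4p pk k0; have p0 : (0 < p)%N by lia.
have pk2 : (2 * p < k)%N by lia.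
have kr0 : 0 < k%:R :> R by rewrite ltr0n.
have pr0 : 0 < p%:R :> R by rewrite ltr0n.
have m1 : 0 < \prod_(j < p) (k - 1 - 2 * j)%N%:R :> R.
  by apply: prodr_gt0 => i _; rewrite ltr0n; have := ltn_ord i; lia.
have m2 : 0 < \prod_(j < p) (2 * j + 1)%N%:R :> R.
  by apply: prodr_gt0 => i _; rewrite ltr0n addn1.
have q0 : 0 < k%:R * expR (-1) :> R by rewrite mulr_gt0// expR_gt0.
rewrite big_split /= -ler_ln ?posrE ?exprn_gt0 ?mulr_gt0//.
rewrite lnXn// lnM ?posrE ?expR_gt0// expRK [leRHS]lnM ?posrE//.
apply: le_trans (lerD (ln_prod_step2_ge pk2) (ln_prod_odd_ge _)).
pose y : R := 2 * p%:R.
have k4pr : k%:R <= 2 * y by rewrite -(ler_nat R) natrM in k4p; rewrite /y; lra.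
have pkr : 16 * y <= 11 * k%:R by rewrite -(ler_nat R) !natrM in pk; rewrite /y; lra.
(* [u] places y = 2p relative to k/2: y = (k/2)(1 + u) and k - y = (k/2)(1 - u). The claim then
   reduces to K u >= 2u ln 2, and 32 p <= 11 k is exactly u <= 3/8. *)
pose u := 2 * y / k%:R - 1.
have uk : u * k%:R = 2 * y - k%:R by rewrite mulrBl mul1r divfK// gt_eqF.
have u0 : 0 <= u by rewrite subr_ge0 ler_pdivlMr// mul1r.
have u1 : u <= 3 / 8 by rewrite -(@ler_pM2r _ k%:R)//; lra.
have := @K_ge u; rewrite u0 u1 => /(_ isT).
rewrite -(@ler_pM2l _ (k%:R / 2)); last by rewrite divr_gt0.
have ey : y = k%:R / 2 * (1 + u) by lra.
have ey' : k%:R - y = k%:R / 2 * (1 - u) by lra.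
have ly : ln y = ln k%:R - ln 2 + ln (1 + u).
  by rewrite ey lnM ?ln_div ?posrE//; lra.
have ly' : ln (k%:R - y) = ln k%:R - ln 2 + ln (1 - u).
  by rewrite ey' lnM ?ln_div ?posrE//; lra.
rewrite -[_ *+ (2 * p)]mulr_natr natrM -/y /h ly ly' /K => H.
have t1 : k%:R * u * ln 2 = (2 * y - k%:R) * ln 2 by rewrite -uk; ring.
have t2 : k%:R * u * ln (1 + u) = (2 * y - k%:R) * ln (1 + u) by rewrite -uk; ring.
have t3 : k%:R * u * ln (1 - u) = (2 * y - k%:R) * ln (1 - u) by rewrite -uk; ring.
lra.
Qed.

End stirling.

(** * Moment orders and numerical constants *)

Section tail_numerics.
Context {R : realType}.
Implicit Types (a b x : R) (k l n p q : nat).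

(** AM-GM: the mean of the factors is n + p - 1. *)
Lemma prod_step2_le n p :
  \prod_(j < p) (n + 2 * j)%N%:R <= (n%:R + p%:R - 1) ^+ p :> R.
Proof.
case: p => [|p]; first by rewrite big_ord0 expr0.
have cT : #|(predT : {pred 'I_p.+1})| = p.+1 by rewrite -[RHS]card_ord; apply: eq_card.
have [|+ _] := @leif_AGM R 'I_p.+1 predT (fun j => (n + 2 * j)%N%:R).
  by move=> i _; rewrite ler0n.
rewrite cT (eq_bigl xpredT)// => /le_trans; apply; rewrite (eq_bigl xpredT)//.
apply: lerXn2r.
- by rewrite nnegrE divr_ge0// sumr_ge0.
- rewrite nnegrE; have n0 : 0 <= n%:R :> R by [].
  by have p1 : 1 <= p.+1%:R :> R by [rewrite ler1n]; lra.
rewrite ler_pdivrMr ?ltr0n//.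
rewrite -natr_sum big_split /= sum_nat_const card_ord -big_distrr /=.
have -> : (2 * \sum_(i < p.+1) i = p.+1 * p)%N.
  by elim: p {cT} => [|p IH]; [rewrite big_ord1|rewrite big_ord_recr /= mulnDr IH; lia].
rewrite -mulnDr natrM mulrC ler_pM2r ?ltr0n// natrD -natr1; lra.
Qed.

(** From exp(-1/64) >= 63/64, then four squarings with rational rounding. *)
Let expR14 : expR (1 / 4) <= (1287 / 1000 : R).
Proof.
have h : expR (1 / 64) <= (1 + (15 + 88 / 100) / 1000 : R).
  have e0 := expR_ge0 (1 / 64 : R).
  have h1 : 63 / 64 <= expR (- (1 / 64)) :> R.
    by apply: le_trans (expR_ge1Dx _); lra.
  have := ler_wpM2l e0 h1; rewrite expRxMexpNx_1.
  lra.
have -> : (1 / 4 : R) = 16%:R * (1 / 64) by lra.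
rewrite expRM_natl (_ : 16 = 2 * 2 * 2 * 2)%N// !exprM.
have sq x y z : 0 <= x -> x <= y -> y ^+ 2 <= z -> 0 <= x ^+ 2 <= z.
  by move=> x0 xy yz; rewrite sqr_ge0/=; nra.
have /andP[p1 h1] := sq _ _ (1 + (32 + 2 / 100) / 1000) (expR_ge0 (1 / 64)) h ltac:(lra).
have /andP[p2 h2] := sq _ _ (1 + (65 + 7 / 100) / 1000) p1 h1 ltac:(lra).
have /andP[p3 h3] := sq _ _ (1 + (134 + 38 / 100) / 1000) p2 h2 ltac:(lra).
by have /andP[] := sq _ _ (1287 / 1000) p3 h3 ltac:(lra).
Qed.

Let expR_half : expR (1 / 2) <= (166 / 100 : R).
Proof.
have -> : (1 / 2 : R) = 2%:R * (1 / 4) by lra.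
by rewrite expRM_natl; have := expR14; have := expR_ge0 (1 / 4 : R); nra.
Qed.

Let expR134 : expR (13 / 4) <= (27 : R).
Proof.
have -> : (13 / 4 : R) = 6%:R * (1 / 2) + 1 / 4 by lra.
rewrite expRD expRM_natl.
have h : 0 <= expR (1 / 2 : R) <= (1 + (656 + 4 / 10) / 1000 : R).
  apply/andP; split; first exact: expR_ge0.
  have -> : (1 / 2 : R) = 2%:R * (1 / 4) by lra.
  by rewrite expRM_natl; have := expR14; have := expR_ge0 (1 / 4 : R); nra.
have h3 : expR (1 / 2) ^+ 3 <= (4 + (544 + 7 / 10) / 1000 : R).
  have : expR (1 / 2) ^+ 3 <= (1 + (656 + 4 / 10) / 1000) ^+ 3 :> R by rewrite lerXn2r ?nnegrE; lra.
  lra.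
have h30 : 0 <= expR (1 / 2) ^+ 3 :> R by rewrite exprn_ge0// expR_ge0.
have h6 : expR (1 / 2) ^+ 6 <= (20 + 66 / 100 : R) by rewrite (exprM _ 3 2); nra.
have := expR14; have := expR_ge0 (1 / 4 : R); nra.
Qed.

(** A chord bound: the tangent at x/2 lies below the exponential at 0 and at 1/2. Weighting these
    two inequalities by 1 - x and x leaves exp(x/2) with coefficient exactly 1. *)
Let expR_chord x : 0 <= x <= 1 -> expR (x / 2) <= 1 + 66 / 100 * x.
Proof.
move=> /andP[x0 x1].
have h1 := @expR_ge1Dx R (- (x / 2)).
have h2 := @expR_ge1Dx R (1 / 2 - x / 2).
have e0 := expR_gt0 (x / 2).
have h1' : expR (x / 2) * (1 - x / 2) <= 1.
  by rewrite -[leRHS](expRxMexpNx_1 (x / 2)) ler_pM2l//; lra.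
have h2' : expR (x / 2) * (1 + 1 / 2 - x / 2) <= 166 / 100.
  apply: le_trans expR_half.
  have -> : expR (1 / 2) = expR (x / 2) * expR (1 / 2 - x / 2) :> R.
    by rewrite -expRD; congr expR; lra.
  rewrite ler_pM2l//; lra.
nra.
Qed.

(** [p] is k/4 rounded up. The last condition follows from 8(k + 3) <= 11 k, that is, from k >= 8,
    which a >= b + 2 and b >= 1 guarantee. *)
Let quarter k : (8 <= k)%N -> exists p,
  [/\ (k <= 4 * p)%N, (4 * p <= k + 3)%N, (2 * p < k)%N & (32 * p <= 11 * k)%N].
Proof. by move=> k8; exists ((k + 3) %/ 4)%N; split; lia. Qed.

Lemma smin_tail_numerics n l a b : 1 <= b -> b + 2 <= a ->
  a ^+ 2 = l%:R -> b ^+ 2 = n%:R ->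
  let s := 2 * expR (- 1 - (a - b) / (a + b) / 4) * (a - b) in
  exists p e, [/\ 0 < e, (2 * p < l - n)%N &
  \prod_(j < p) (n + 2 * j)%N%:R * (s ^+ 2 + e) ^+ p <=
  expR (- ((a - b) ^+ 2 / 8)) *
  \prod_(j < p) ((l - n - 1 - 2 * j)%N%:R * (2 * j + 1)%N%:R)].
Proof.
move=> b1 ab al bn s.
set dl := (a - b) / (a + b).
have d0 : 0 < dl by rewrite divr_gt0//; lra.
have dE : dl * (a + b) = a - b by rewrite divfK// gt_eqF//; lra.
have nl : (n < l)%N by rewrite -(ltr_nat R) -al -bn; nra.
pose k := (l - n)%N.
have kE : k%:R = (a - b) * (a + b) by rewrite natrB ?(ltnW nl)// -al -bn; ring.
have k8 : (8 <= k)%N by rewrite -(ler_nat R) kE; nra.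
have [p [k4p pk pk2 pk32]] := quarter k8.
have k0 : (0 < k)%N by exact: leq_trans k8.
have p1 : (0 < p)%N.
  by move: k4p; case: (p) => //; rewrite muln0 leqn0 => /eqP k_eq0; rewrite k_eq0 in k0.
have k4pr : k%:R <= 4 * p%:R :> R by rewrite -natrM ler_nat.
have pkr : 4 * p%:R <= k%:R + 3 :> R by rewrite -natrM -natrD ler_nat.
have p1r : 1 <= p%:R :> R by rewrite ler1n.
have s2E : s ^+ 2 = 4 * (expR (- 1) ^+ 2 * expR (- (dl / 2))) * (a - b) ^+ 2.
  rewrite /s !exprMn -/dl -!expRM_natl -expRD; congr (_ * expR _ * _); lra.
have s0 : 0 < s ^+ 2.
  by rewrite s2E !mulr_gt0 ?exprn_gt0 ?expR_gt0//; lra.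
have np0 : 0 < 4 * (n%:R + p%:R) :> R by have : 0 <= n%:R :> R by []; lra.
(* The term -1 in the mean n + p - 1 pays for two losses: rounding [p] up costs at most 3/4, and
   this [e] costs at most 1/4 of s^2. *)
pose e := s ^+ 2 / (4 * (n%:R + p%:R)).
have e0 : 0 < e by rewrite divr_gt0.
have eE : 4 * (n%:R + p%:R) * e = s ^+ 2 by rewrite /e mulrC divfK// gt_eqF.
exists p, e; split => //.
have base : (n%:R + p%:R - 1) * (s ^+ 2 + e) <=
    (k%:R * expR (- 1)) ^+ 2 * expR (- (dl / 2)).
  have h1 : (n%:R + p%:R - 1) * (s ^+ 2 + e) <= (n%:R + k%:R / 4) * s ^+ 2 by nra.
  apply: le_trans h1 _.
  rewrite s2E exprMn kE -bn.
  set E := expR (-1) ^+ 2; set E' := expR (- (dl / 2)).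
  have EE0 : 0 <= E * E' * (a - b) ^+ 2.
    apply: mulr_ge0; last exact: sqr_ge0.
    by apply: mulr_ge0; [apply: exprn_ge0|]; exact: expR_ge0.
  have h2 : 4 * (b ^+ 2 + (a - b) * (a + b) / 4) <= (a + b) ^+ 2 by nra.
  have := ler_wpM2r EE0 h2; lra.
have base0 : 0 <= (n%:R + p%:R - 1) * (s ^+ 2 + e).
  by apply: mulr_ge0; [have : 0 <= n%:R :> R by []; lra|lra].
apply: (@le_trans _ _ (((n%:R + p%:R - 1) * (s ^+ 2 + e)) ^+ p)).
  rewrite [leRHS]exprMn; apply: ler_wpM2r; last exact: prod_step2_le.
  by apply: exprn_ge0; lra.
have basep := lerXn2r p _ _ base; rewrite !nnegrE in basep.
apply: le_trans (basep base0 (le_trans base0 base)) _.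
rewrite exprMn -exprM mulrC -expRM_natl.
apply: ler_pM; rewrite ?expR_ge0//.
  rewrite ler_expR mulrN lerN2.
  have : k%:R * dl = (a - b) ^+ 2 by rewrite kE -mulrA [(a + b) * _]mulrC dE.
  have := ler_wpM2r (ltW d0) k4pr; lra.
exact: prod_step2_odd_ge.
Qed.

Lemma smax_tail_numerics n l a b : 1 <= b -> b + 2 <= a ->
  a ^+ 2 = l%:R -> b ^+ 2 = n%:R ->
  let S := 99 / 100 * (2 * expR (- 1 - (a - b) / (a + b) / 4) * (3 * a + b)) in
  exists q,
  \prod_(j < q) ((l + 2 * j)%N%:R * (n + 2 * j)%N%:R) <=
  expR (- ((a - b) ^+ 2 / 8)) *
  (\prod_(j < q) (2 * j + 1)%N%:R * S ^+ (2 * q)).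
Proof.
move=> b1 ab al bn S.
set dl := (a - b) / (a + b).
have d0 : 0 < dl by rewrite divr_gt0//; lra.
have dE : dl * (a + b) = a - b by rewrite divfK// gt_eqF//; lra.
have d1 : dl <= 1 by rewrite ler_pdivrMr; lra.
(* Each of the [q] factors below gains [expR (- (1 / 4))], so
   [(a - b) ^+ 2 / 2 <= q] is needed. *)
pose x : R := a * (a + b) / 2.
have x0 : 0 < x by rewrite /x; nra.
pose q := (Num.truncn x).+1.
have /andP[qx xq] : (Num.truncn x)%:R <= x < q%:R by apply: truncn_itv; exact: ltW.
have q1x : q%:R - 1 <= x by rewrite /q -natr1; lra.
exists q.
have n0 : 0 <= n%:R :> R by [].
have l0 : 0 <= l%:R :> R by [].
have q0 : 1 <= q%:R :> R by rewrite ler1n.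
have S2E : S ^+ 2 = (98 + 1 / 100) / 100 * 4 * (expR (- 1) ^+ 2 * expR (- (dl / 2))) *
    (3 * a + b) ^+ 2.
  rewrite /S !exprMn -/dl -!expRM_natl -expRD.
  have -> : 2%:R * (- 1 - dl / 4) = 2%:R * -1 + - (dl / 2) :> R by lra.
  lra.
have base : (l%:R + x) * (n%:R + x) <=
    expR (- (1 / 4)) * (2 * x * expR (- 1) * S ^+ 2).
  (* All exponentials are moved to one side as [F], with 13/4 = 1/4 + 1 + 2 collecting the constant
     part. *)
  have E1 : expR (- (1 / 4)) * expR (- 1) * (expR (- 1) ^+ 2 * expR (- (dl / 2))) *
      (expR (13 / 4) * expR (dl / 2)) = 1 :> R.
    rewrite -expRM_natl -!expRD -[RHS]expR0; congr expR; lra.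
  set F := expR (13 / 4) * expR (dl / 2) in E1.
  have F0 : 0 < F by rewrite mulr_gt0 ?expR_gt0.
  rewrite -(ler_pM2l F0).
  have -> : F * (expR (- (1 / 4)) * (2 * x * expR (-1) * S ^+ 2)) =
     2 * x * ((98 + 1 / 100) / 100 * 4) * (3 * a + b) ^+ 2.
    rewrite S2E -[RHS]mul1r -[X in _ = X * _]E1; ring.
  have hF : F * (a + b) <= 27 * (a + b + 66 / 100 * (a - b)).
    rewrite /F -mulrA -dE; apply: ler_pM => //; rewrite ?expR_ge0 ?mulr_ge0 ?expR_ge0//.
    - lra.
    - have := @expR_chord dl; rewrite (ltW d0) d1 => /(_ isT) H.
      have ab0 : 0 <= a + b by lra.
      have := ler_wpM2r ab0 H; lra.
  rewrite -al -bn /x.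
  (* This factorization is the reason for the choice of [x]: it cancels one of the two factors 3a +
     b in S^2. *)
  have -> : a ^+ 2 + a * (a + b) / 2 = a * (3 * a + b) / 2 by lra.
  have -> : b ^+ 2 + a * (a + b) / 2 = (a ^+ 2 + a * b + 2 * b ^+ 2) / 2 by lra.
  have ab0 : 0 < a + b by lra.
  rewrite -(ler_pM2r ab0).
  set w := a ^+ 2 + a * b + 2 * b ^+ 2.
  have w0 : 0 <= w by rewrite /w; nra.
  have c0 : 0 <= a * (3 * a + b) * w / 4 by rewrite divr_ge0// mulr_ge0//; nra.
  have := ler_wpM2l c0 hF.
  have -> : F * (a * (3 * a + b) / 2 * (w / 2)) * (a + b) =
     a * (3 * a + b) * w / 4 * (F * (a + b)) by field.
  move/le_trans; apply.
  have -> : 2 * (a * (a + b) / 2) * ((98 + 1 / 100) / 100 * 4) * (3 * a + b) ^+ 2 * (a + b) =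
     a * (3 * a + b) / 4 * ((98 + 1 / 100) / 100 * 16 * (a + b) ^+ 2 * (3 * a + b)) by field.
  have -> : a * (3 * a + b) * w / 4 * (27 * (a + b + 66 / 100 * (a - b))) =
     a * (3 * a + b) / 4 * (w * (27 * (a + b + 66 / 100 * (a - b)))) by field.
  apply: ler_wpM2l; first by nra.
  (* In [b] and [c], both nonnegative, the cubic inequality holds coefficient by coefficient. The
     tightest one is at c^3, 44.82 against 47.04; it limits how far 99/100 could be lowered. *)
  rewrite /w; pose c := a - b.
  have -> : a = b + c by rewrite /c; lra.
  have c2 : 0 <= c by rewrite /c; lra.
  have b3 : 0 <= b ^+ 3 by rewrite exprn_ge0//; lra.
  have b2c : 0 <= b ^+ 2 * c by rewrite mulr_ge0 ?exprn_ge0//; lra.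
  have bc2 : 0 <= b * c ^+ 2 by rewrite mulr_ge0 ?exprn_ge0//; lra.
  have c3 : 0 <= c ^+ 3 by rewrite exprn_ge0//.
  lra.
have step (N : nat) : (0 : R) <= N%:R + q%:R - 1 <= N%:R + x.
  by have : 0 <= N%:R :> R by []; lra.
apply: (@le_trans _ _ (((l%:R + x) * (n%:R + x)) ^+ q)).
  rewrite big_split exprMn /=; apply: ler_pM; rewrite ?prodr_ge0//;
    (apply: le_trans (prod_step2_le _ _) _;
     have /andP[s1 s2] := step l; have /andP[s3 s4] := step n;
     apply: lerXn2r; rewrite ?nnegrE; lra).
have base0 : 0 <= (l%:R + x) * (n%:R + x) by apply: mulr_ge0; lra.
have baseq := lerXn2r q _ _ base; rewrite !nnegrE in baseq.
apply: le_trans (baseq base0 (le_trans base0 base)) _.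
rewrite exprMn -expRM_natl; apply: ler_pM; rewrite ?expR_ge0 ?exprn_ge0//.
- by rewrite !mulr_ge0 ?expR_ge0 ?sqr_ge0//; lra.
- rewrite ler_expR mulrN lerN2; rewrite /x in xq; nra.
rewrite exprMn -exprM ler_wpM2r ?exprn_even_ge0 ?oddM//.
apply: le_trans (prod_odd_ge _); apply: lerXn2r; rewrite ?nnegrE.
- by rewrite !mulr_ge0 ?expR_ge0//; lra.
- by rewrite !mulr_ge0 ?expR_ge0//; lra.
- by rewrite ler_wpM2r ?expR_ge0//; lra.
Qed.
End tail_numerics.

(** * Tail events through an independent copy *)

Section second_copy.
Context {R : realType} d (T : measurableType d) (P : probability T R) (l m : nat).
Variable Om : T -> 'M[R]_(l, m).
Hypothesis gOm : gaussian_matrix P Om.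

(** The copy is [Om] at a second point of the same space, integrated out; the result is a function
    on [T] and defines events there. *)
Definition copy_average (f : 'M[R]_(l, m) -> 'M[R]_(l, m) -> R) (w : T) : \bar R :=
  (\int[P]_w' (f (Om w) (Om w'))%:E)%E.

(** Markov's inequality after exchanging the copies by Tonelli: the first matrix is integrated with
    the second one frozen, where the moment bound [g N] is known, and [g] is integrated last. *)
Lemma copy_average_markov (f : 'M[R]_(l, m) -> 'M[R]_(l, m) -> R)
    (g : 'M[R]_(l, m) -> R) (a t : R) :
  measurable_fun setT (fun z : T * T => f (Om z.1) (Om z.2)) ->
  (forall M N, 0 <= f M N) -> (forall N, tame (f^~ N)) -> tame g ->
  (forall N, gexp P Om (f^~ N) <= g N) -> 0 < a -> gexp P Om g <= t * a ->
  measurable [set w | (a%:E <= copy_average f w)%E] /\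
  (P [set w | a%:E <= copy_average f w] <= t%:E)%E.
Proof.
move=> mf f0 tf tg fg a0 gt.
pose F (z : T * T) : \bar R := (f (Om z.1) (Om z.2))%:E.
have mF : measurable_fun setT F by exact/measurable_EFinP.
have F0 z : (0 <= F z)%E by rewrite lee_fin.
have mZ : measurable_fun setT (copy_average f) := measurable_fun_fubini_tonelli_F F mF F0.
have Z0 w : (0 <= copy_average f w)%E by apply: integral_ge0 => w' _; rewrite lee_fin.
have mE : measurable [set w | (a%:E <= copy_average f w)%E].
  by have := emeasurable_fun_c_infty measurableT mZ a%:E; rewrite setTI.
split=> //.
rewrite -(@lee_pmul2l _ a%:E) ?lte_fin// -[leRHS]EFinM mulrC.
apply: (@le_trans _ _ (gexp P Om g)%:E); last by rewrite lee_fin.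
rewrite -integral_cst//.
apply: (@le_trans _ _ (\int[P]_w copy_average f w)%E).
  apply: (@le_trans _ _ (\int[P]_(w in [set w | (a%:E <= copy_average f w)%E]) copy_average f w)%E).
    by apply: ge0_le_integral => //; [move=> *; exact: ltW|exact: measurable_funTS].
  by apply: ge0_subset_integral.
rewrite (fubini_tonelli F mF F0) (EFin_gexp gOm tg).
have [mg _ _] := tg.
apply: ge0_le_integral => //.
- by move=> w _; apply: integral_ge0 => w' _; rewrite lee_fin.
- exact: (measurable_fun_fubini_tonelli_G F mF F0).
- apply/measurable_EFinP; apply: (measurableT_comp mg).
  exact: gaussian_measurable_mat gOm.
- by move=> w _; have := EFin_gexp gOm (tf (Om w)) => /= <-; rewrite lee_fin.
Qed.

Lemma copy_average_ge (f : 'M[R]_(l, m) -> 'M[R]_(l, m) -> R) (h : 'M[R]_(l, m) -> R) w :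
  tame (f (Om w)) -> tame h -> (forall N, h N <= f (Om w) N) ->
  ((gexp P Om h)%:E <= copy_average f w)%E.
Proof. by move=> tf th hf; rewrite /copy_average -(EFin_gexp gOm tf) lee_fin; exact: le_gexp. Qed.

Lemma copy_measurable_mx :
  measurable_mx (fun z : T * T => Om z.1) /\ measurable_mx (fun z : T * T => Om z.2).
Proof.
by split=> i j; apply: (measurableT_comp (gaussian_measurable_mx gOm i j));
  [exact: measurable_fst|exact: measurable_snd].
Qed.

End second_copy.

Lemma tame_quad {R : realType} l m p (v : 'M[R]_(l, m) -> 'cV[R]_p) :
  tame_mx v -> tame (fun M => vnorm (v M) ^+ 2).
Proof.
move=> tv; under eq_fun do rewrite sqr_vnormE.
exact: (tame_mulmx (tame_trmx tv) tv).
Qed.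

Section gaussian_moments.
Context {R : realType} d (T : measurableType d) (P : probability T R) (l m : nat).
Variable Om : T -> 'M[R]_(l, m).
Hypothesis gOm : gaussian_matrix P Om.

Lemma gexp_bilinear (u : 'cV[R]_l) (x : 'cV[R]_m) p :
  gexp P Om (fun M => (((u^T *m M *m x) 0 0) ^+ 2) ^+ p) =
  (vnorm u ^+ 2 * vnorm x ^+ 2) ^+ p * \prod_(j < p) (2 * j + 1)%N%:R.
Proof.
pose c (_ : 'I_1) : 'M[R]_(l, m) := u *m x^T.
have orth a b : \sum_i \sum_j c a i j * c b i j =
    (vnorm u ^+ 2 * vnorm x ^+ 2) *+ (a == b).
  rewrite !ord1 eqxx mulr1n !sqr_vnorm mulr_suml; apply: eq_bigr => i _.
  rewrite mulr_sumr; apply: eq_bigr => j _.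
  by rewrite /c !mxE !big_ord1 !mxE; ring.
have := gexp_linear_image gOm orth p.
under [X in _ = _ * X]eq_bigr do rewrite addnC.
move=> <-; congr (gexp P Om _); apply/funext => M.
rewrite big_ord1; congr (_ ^+ _ ^+ _).
rewrite -mulmxA mxE; apply: eq_bigr => i _.
rewrite [(u^T) _ _]mxE [(M *m x) _ _]mxE mulr_sumr; apply: eq_bigr => j _.
by rewrite /c [(_ *m _) i j]mxE big_ord1 !mxE; ring.
Qed.

Lemma gexp_vnorm_mulmx (x : 'cV[R]_m) p :
  gexp P Om (fun M => (vnorm (M *m x) ^+ 2) ^+ p) =
  (vnorm x ^+ 2) ^+ p * \prod_(j < p) (l + 2 * j)%N%:R.
Proof.
pose c (a : 'I_l) : 'M[R]_(l, m) := delta_mx a 0 *m x^T.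
have cE a i j : c a i j = (i == a)%:R * x j 0.
  by rewrite /c mxE big_ord1 !mxE andbT.
have orth a b : \sum_i \sum_j c a i j * c b i j = vnorm x ^+ 2 *+ (a == b).
  rewrite (bigD1 a)//= [X in _ + X]big1 => [|i /negbTE ia]; last first.
    by rewrite big1// => j _; rewrite cE ia mul0r mul0r.
  rewrite addr0 sqr_vnorm -sumrMnl; apply: eq_bigr => j _.
  by rewrite !cE eqxx mul1r; case: (a == b); rewrite ?mul1r ?mul0r ?mulr0 ?mulr1n ?mulr0n// expr2.
rewrite -(gexp_linear_image gOm orth p); congr (gexp P Om _); apply/funext => M.
rewrite sqr_vnorm; congr (_ ^+ _); apply: eq_bigr => a _; congr (_ ^+ _).
rewrite (bigD1 a)//= [X in _ + X]big1 => [|i /negbTE ia]; last first.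
  by rewrite big1// => j _; rewrite cE ia mul0r mul0r.
by rewrite addr0 mxE; apply: eq_bigr => j _; rewrite cE eqxx mul1r mulrC.
Qed.

Variables (n : nat) (Q : 'M[R]_(m, n)).
Hypothesis QQ : Q^T *m Q = 1%:M.

(** Orthonormality of the columns q_a of [Q] makes the coefficient matrices u q_a^T orthogonal, so
    [M *m Q] has the moments of a Gaussian matrix with [n] columns. *)
Lemma gexp_vnorm_trmx_mulmx (u : 'cV[R]_l) p :
  gexp P Om (fun M => (vnorm ((M *m Q)^T *m u) ^+ 2) ^+ p) =
  (vnorm u ^+ 2) ^+ p * \prod_(j < p) (n + 2 * j)%N%:R.
Proof.
pose c (a : 'I_n) : 'M[R]_(l, m) := u *m (col a Q)^T.
have cE a i j : c a i j = u i 0 * Q j a.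
  by rewrite /c mxE big_ord1 !mxE.
have orth a b : \sum_i \sum_j c a i j * c b i j = vnorm u ^+ 2 *+ (a == b).
  have /(congr1 (fun M : 'M[R]_n => M a b)) := QQ; rewrite !mxE => h.
  rewrite sqr_vnorm -[RHS]mulr_natr -h mulr_suml; apply: eq_bigr => i _.
  by rewrite mulr_sumr; apply: eq_bigr => j _; rewrite !cE mxE; ring.
rewrite -(gexp_linear_image gOm orth p); congr (gexp P Om _); apply/funext => M.
rewrite sqr_vnorm; congr (_ ^+ _); apply: eq_bigr => a _; congr (_ ^+ _).
rewrite mxE; apply: eq_bigr => i _; rewrite !mxE mulr_suml; apply: eq_bigr => j _.
by rewrite cE; ring.
Qed.

Variables (u0 : 'cV[R]_l) (x0 : 'cV[R]_m).
Hypotheses (u1 : vnorm u0 = 1) (x1 : vnorm x0 = 1).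

Let mG : measurable_mx (fun z : T * T => Om z.1 *m Q).
Proof.
by apply: measurable_mulmx; [exact: (copy_measurable_mx gOm).1|exact: measurable_mx_cst].
Qed.

(** [E] says that the copy average reaches D S^(2q). It does not mention [v], so one exceptional
    event serves all [v]: a single [v] with |G v| > S |v| already forces the average up to that
    level. *)
Lemma smax_tail q (S t : R) : 0 < S ->
  \prod_(j < q) ((l + 2 * j)%N%:R * (n + 2 * j)%N%:R) <=
    t * (\prod_(j < q) (2 * j + 1)%N%:R * S ^+ (2 * q)) ->
  exists E : set T, [/\ measurable E, (P E <= t%:E)%E & forall w, ~ E w ->
    forall v, vnorm (Om w *m Q *m v) <= S * vnorm v].
Proof.
move=> S0 ht.
set D := \prod_(j < q) (2 * j + 1)%N%:R in ht.
have D0 : 0 < D by apply: prodr_gt0 => j _; rewrite ltr0n addn1.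
pose f (M N : 'M[R]_(l, m)) := (vnorm ((M *m Q)^T *m (N *m x0)) ^+ 2) ^+ q.
pose g (N : 'M[R]_(l, m)) := (vnorm (N *m x0) ^+ 2) ^+ q * \prod_(j < q) (n + 2 * j)%N%:R.
have tg0 : tame (fun N : 'M[R]_(l, m) => (vnorm (N *m x0) ^+ 2) ^+ q).
  by apply: tameX; apply: tame_quad; apply: tame_mulmx; [exact: tame_mx_id|exact: tame_mx_cst].
have DS : 0 < D * S ^+ (2 * q) by rewrite mulr_gt0// exprn_gt0.
have [|||||||mE PE] := @copy_average_markov _ _ _ P _ _ _ gOm f g (D * S ^+ (2 * q)) t.
- do 2 apply: measurable_funX; apply: measurable_vnorm; apply: measurable_mulmx.
    exact: measurable_trmx.
  by apply: measurable_mulmx; [exact: (copy_measurable_mx gOm).2|exact: measurable_mx_cst].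
- by move=> M N; rewrite /f !exprn_ge0// vnorm_ge0.
- move=> N; apply: tameX; apply: tame_quad; apply: tame_mulmx; last exact: tame_mx_cst.
  by apply: tame_trmx; apply: tame_mulmx; [exact: tame_mx_id|exact: tame_mx_cst].
- by apply: tameM => //; exact: tame_cst.
- by move=> N; rewrite /f /g gexp_vnorm_trmx_mulmx.
- by [].
- rewrite /g; under [X in gexp P Om X]eq_fun do rewrite mulrC.
  rewrite (gexpZ gOm)// gexp_vnorm_mulmx x1 expr1n expr1n mul1r.
  by rewrite mulrC -big_split.
exists [set w | ((D * S ^+ (2 * q))%:E <= copy_average P Om f w)%E]; split => // w.
move=> /negP; rewrite -ltNge => Ew v; rewrite leNgt; apply/negP => hv.
have v0 : 0 < vnorm v.
  rewrite lt_neqAle vnorm_ge0 andbT eq_sym; apply/eqP => /vnorm0_eq0 vz.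
  by move: hv; rewrite vz mulmx0 !vnorm0 mulr0 ltxx.
set y := Om w *m Q *m v in hv.
(* The Cauchy-Schwarz minorant of [f (Om w)]: a power of a single normal variable of variance |G
   v|^2, divided by |v|^(2q). *)
pose h (N : 'M[R]_(l, m)) := (vnorm v ^+ 2) ^- q * (((y^T *m N *m x0) 0 0) ^+ 2) ^+ q.
have th0 : tame (fun N : 'M[R]_(l, m) => (((y^T *m N *m x0) 0 0) ^+ 2) ^+ q).
  do 2 apply: tameX; apply: (tame_mulmx (B := fun=> x0)); last exact: tame_mx_cst.
  by apply: tame_mulmx; [exact: tame_mx_cst|exact: tame_mx_id].
move: Ew; apply/negP; rewrite -leNgt.
have := @copy_average_ge _ _ _ P _ _ _ gOm f h w.
move=> H; apply: (le_trans _ (H _ _ _)).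
- rewrite /h (gexpZ gOm)// gexp_bilinear x1 expr1n mulr1 lee_fin.
  rewrite mulrA mulrC ler_wpM2r ?(ltW D0)// exprM -exprVn -exprMn.
  apply: lerXn2r; rewrite ?nnegrE ?sqr_ge0 ?mulr_ge0 ?invr_ge0 ?sqr_ge0 ?vnorm_ge0//.
  rewrite mulrC ler_pdivlMr ?exprn_gt0// -exprMn.
  by apply: lerXn2r (ltW hv); rewrite nnegrE ?vnorm_ge0// mulr_ge0// ltW.
- apply: tameX; apply: tame_quad; apply: tame_mulmx; first exact: tame_mx_cst.
  by apply: tame_mulmx; [exact: tame_mx_id|exact: tame_mx_cst].
- by apply: tameM => //; exact: tame_cst.
- move=> N; rewrite /h /f -exprVn -exprMn; apply: lerXn2r; rewrite ?nnegrE.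
  + by rewrite mulr_ge0 ?invr_ge0 ?sqr_ge0.
  + exact: sqr_ge0.
  + rewrite mulrC ler_pdivrMr ?exprn_gt0//.
    have -> : y^T *m N *m x0 = v^T *m ((Om w *m Q)^T *m (N *m x0)).
      by rewrite /y trmx_mul !mulmxA.
    by rewrite mulrC; exact: cauchy_schwarz.
Qed.

(** The inverse form is large as soon as [G] shortens one vector [v] too much; again the event is
    stated through the average and is the same for all [v]. *)
Lemma smin_tail p (e s t : R) : 0 < e -> 0 <= s -> (2 * p < l - n)%N ->
  \prod_(j < p) (n + 2 * j)%N%:R * (s ^+ 2 + e) ^+ p <=
    t * \prod_(j < p) ((l - n - 1 - 2 * j)%N%:R * (2 * j + 1)%N%:R) ->
  exists E : set T, [/\ measurable E, (P E <= t%:E)%E & forall w, ~ E w ->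
    forall v, s * vnorm v <= vnorm (Om w *m Q *m v)].
Proof.
move=> e0 s0 pln ht.
set D := \prod_(j < p) (2 * j + 1)%N%:R : R.
have D0 : 0 < D by apply: prodr_gt0 => j _; rewrite ltr0n addn1.
set K := \prod_(j < p) (l - n - 1 - 2 * j)%N%:R : R.
have K0 : 0 < K by apply: prodr_gt0 => j _; rewrite ltr0n; have := ltn_ord j; lia.
have se0 : 0 < s ^+ 2 + e by rewrite ltr_wpDl// sqr_ge0.
pose xi (N : 'M[R]_(l, m)) := (N *m Q)^T *m u0.
pose f (M N : 'M[R]_(l, m)) := (((xi N)^T *m (resolvent e (M *m Q) *m xi N)) 0 0) ^+ p.
pose g (N : 'M[R]_(l, m)) := (vnorm (xi N) ^+ 2) ^+ p * K^-1.
have txi : tame_mx xi.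
  apply: (tame_mulmx (B := fun=> u0)); last exact: tame_mx_cst.
  by apply: tame_trmx; apply: tame_mulmx; [exact: tame_mx_id|exact: tame_mx_cst].
have tg0 : tame (fun N => (vnorm (xi N) ^+ 2) ^+ p).
  by apply: tameX; exact: tame_quad.
have f0 M N : 0 <= ((xi N)^T *m (resolvent e (M *m Q) *m xi N)) 0 0.
  by rewrite mulmxA; exact: resolvent_quad_ge0.
have DS : 0 < D / (s ^+ 2 + e) ^+ p by rewrite divr_gt0// exprn_gt0.
have [|||||||mE PE] := @copy_average_markov _ _ _ P _ _ _ gOm f g (D / (s ^+ 2 + e) ^+ p) t.
- apply: measurable_funX.
  have mxi : measurable_mx (fun z : T * T => xi (Om z.2)).
    apply: measurable_mulmx; last exact: measurable_mx_cst.
    apply: measurable_trmx; apply: measurable_mulmx; last exact: measurable_mx_cst.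
    exact: (copy_measurable_mx gOm).2.
  have mR : measurable_mx (fun z : T * T => resolvent e (Om z.1 *m Q)).
    apply: measurable_invmx => [a b|z]; last exact: reg_gram_unit.
    under eq_fun do rewrite mxE.
    apply: measurable_funD; last exact: measurable_cst.
    exact: (measurable_mulmx (measurable_trmx mG) mG).
  exact: (measurable_mulmx (measurable_trmx mxi) (measurable_mulmx mR mxi)).
- by move=> M N; rewrite exprn_ge0.
- move=> N; apply: tameX.
  apply: (tame_mulmx (A := fun=> (xi N)^T)); first exact: tame_mx_cst.
  apply: tame_mulmx; last exact: tame_mx_cst.
  exact: tame_resolvent.
- by apply: tameM => //; exact: tame_cst.
- move=> N; rewrite ler_pdivlMr// -exprM.
  exact: (inverse_moment gOm (xi N) QQ e0 pln).
- by [].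
- rewrite /g; under [X in gexp P Om X]eq_fun do rewrite mulrC.
  rewrite (gexpZ gOm)// gexp_vnorm_trmx_mulmx u1 expr1n expr1n mul1r.
  rewrite mulrC ler_pdivrMr// !mulrA -[t * D * _ * K]mulrAC ler_pdivlMr ?exprn_gt0//.
  by rewrite -mulrA [D * K]mulrC -big_split.
exists [set w | ((D / (s ^+ 2 + e) ^+ p)%:E <= copy_average P Om f w)%E]; split => // w.
move=> /negP; rewrite -ltNge => Ew v; rewrite leNgt; apply/negP => hv.
have v0 : 0 < vnorm v.
  rewrite lt_neqAle vnorm_ge0 andbT eq_sym; apply/eqP => /vnorm0_eq0 vz.
  by move: hv; rewrite vz mulmx0 !vnorm0 mulr0 ltxx.
set c := vnorm (Om w *m Q *m v) ^+ 2 + e * vnorm v ^+ 2.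
have c0 : 0 < c by rewrite ltr_wpDl ?sqr_ge0// mulr_gt0// exprn_gt0.
(* The minorant from [resolvent_cauchy_schwarz] at z = v. The bilinear term is normal of variance
   |v|^2, as [Q] is isometric, while [hv] gives c < (s^2 + e) |v|^2. *)
pose h (N : 'M[R]_(l, m)) := c ^- p * (((u0^T *m N *m (Q *m v)) 0 0) ^+ 2) ^+ p.
have th0 : tame (fun N : 'M[R]_(l, m) => (((u0^T *m N *m (Q *m v)) 0 0) ^+ 2) ^+ p).
  do 2 apply: tameX; apply: (tame_mulmx (B := fun=> Q *m v)); last exact: tame_mx_cst.
  by apply: tame_mulmx; [exact: tame_mx_cst|exact: tame_mx_id].
move: Ew; apply/negP; rewrite -leNgt.
have := @copy_average_ge _ _ _ P _ _ _ gOm f h w.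
move=> H; apply: (le_trans _ (H _ _ _)).
- rewrite /h (gexpZ gOm)// gexp_bilinear u1 expr1n mul1r lee_fin vnorm_isometry//.
  rewrite mulrA mulrC ler_wpM2r ?(ltW D0)// -!exprVn -exprMn.
  apply: lerXn2r; rewrite ?nnegrE ?mulr_ge0 ?invr_ge0 ?sqr_ge0 ?(ltW c0) ?(ltW se0) ?vnorm_ge0//.
  rewrite mulrC ler_pdivlMr// mulrC ler_pdivrMr// /c mulrDr [vnorm v ^+ 2 * e]mulrC.
  rewrite lerD2r mulrC -exprMn.
  by apply: lerXn2r (ltW hv); rewrite nnegrE ?vnorm_ge0// mulr_ge0// vnorm_ge0.
- apply: tameX; apply: (tame_mulmx (tame_trmx txi)).
  by apply: tame_mulmx => //; exact: tame_mx_cst.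
- by apply: tameM => //; exact: tame_cst.
- move=> N; rewrite /h /f -exprVn -exprMn; apply: lerXn2r; rewrite ?nnegrE.
  + by rewrite mulr_ge0 ?invr_ge0 ?sqr_ge0 ?(ltW c0).
  + exact: f0.
  + rewrite mulrC ler_pdivrMr//.
    have -> : u0^T *m N *m (Q *m v) = (xi N)^T *m v.
      by rewrite /xi trmx_mul trmxK !mulmxA.
    by rewrite mulmxA; exact: resolvent_cauchy_schwarz.
Qed.

End gaussian_moments.

(** * Assembling the bound on the condition number *)

Section combination.
Context {R : realType}.

Lemma condX_lt_of_bounds l m n (A Q : 'M[R]_(m, n)) (U : 'M[R]_n) (Om : 'M[R]_(l, m))
    (s S c : R) : (0 < n)%N -> \rank A = n -> Q^T *m Q = 1%:M -> A = Q *m U ->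
  0 < s -> 0 <= S -> S < c * s ->
  (forall v, s * vnorm v <= vnorm (Om *m Q *m v)) ->
  (forall v, vnorm (Om *m Q *m v) <= S * vnorm v) ->
  (condX A Om < c%:E)%E.
Proof.
move=> n0 rA QQ AE s0 S0 Sc lo hi.
have A1E v : Om *m A *m v = Om *m Q *m (U *m v) by rewrite AE !mulmxA.
have nA v : vnorm (A *m v) = vnorm (U *m v) by rewrite AE -mulmxA vnorm_isometry.
have lo' v : s * vnorm (A *m v) <= vnorm (Om *m A *m v) by rewrite A1E nA.
have hi' v : vnorm (Om *m A *m v) <= S * vnorm (A *m v) by rewrite A1E nA.
apply/(condX_lt Om c n0 rA); split.
  apply/eqP => OA0; have [e e0 he] := full_rank_vnorm_ge rA.
  have := lo' (delta_mx (Ordinal n0) 0); rewrite OA0 mul0mx vnorm0 leNgt => /negP; apply.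
  rewrite mulr_gt0//; apply: (lt_le_trans _ (he _)).
  by rewrite delta_vnorm mulr1.
(* [condX_lt] asks for a rational strictly below [c]; it is taken between S / s and [c]. *)
have Ssc : S / s < c by rewrite ltr_pdivrMr.
have [r] := rat_in_itvoo Ssc; rewrite in_itv/= => /andP[/ltW Sr rc]; exists r => // u v.
move: Sr; rewrite ler_pdivrMr// => Sr.
have r0 : 0 <= ratr r :> R by rewrite -(pmulr_lge0 _ s0) (le_trans S0).
apply: (@le_trans _ _ (vnorm (A *m u) * ((ratr r * s) * vnorm (A *m v)))).
  rewrite ler_wpM2l ?vnorm_ge0//; apply: (le_trans (hi' v)).
  by rewrite ler_wpM2r ?vnorm_ge0.
have := ler_wpM2r (vnorm_ge0 (A *m v)) (ler_wpM2l r0 (lo' u)).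
nra.
Qed.

(** There is no unit vector, and the [sup] of the empty set is 0. At n = 0 the threshold is 3, so
    the event is empty. *)
Lemma condX_n0 l m (A : 'M[R]_(m, 0)) (Om : 'M[R]_(l, m)) : condX A Om = 0%E.
Proof.
rewrite /condX.
have -> : \rank (Om *m A) == 0 by rewrite -leqn0 rank_leq_col.
rewrite /cond /sigma_max.
rewrite (_ : [set x : 'cV[R]_0 | vnorm x = 1] = set0); last first.
  rewrite -subset0 => x /=; rewrite flatmx0 vnorm0 => /eqP.
  by rewrite eq_sym oner_eq0.
by rewrite image_set0 sup0 mul0r.
Qed.

End combination.

Theorem theorem3p5 (R : realType) (d : measure_display) (T : measurableType d)
    (P : probability T R) (l m n : nat) (A : 'M[R]_(m, n))
    (Om : T -> 'M[R]_(l, m)) :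
  (n <= m)%N -> \rank A = n -> (n < l)%N ->
  gaussian_matrix P Om ->
  (P [set w | ((3 + Num.sqrt (n%:R / l%:R)) / (1 - Num.sqrt (n%:R / l%:R)))%:E
              <= condX A (Om w)]
   <= (2 * expR (- ((Num.sqrt (l%:R : R) - Num.sqrt (n%:R : R)) ^+ 2 / 8)))%:E)%E.
Proof.
move=> nm rA nl gOm.
have [n0|n0] := posnP n.
  subst n; rewrite mul0r sqrtr0 addr0 subr0 divr1 [X in P X](_ : _ = set0); last first.
    by rewrite -subset0 => w /=; rewrite condX_n0 lee_fin leNgt ltr0n.
  by rewrite measure0 lee_fin mulr_ge0// expR_ge0.
set a := Num.sqrt (l%:R : R); set b := Num.sqrt (n%:R : R).
have a2 : a ^+ 2 = l%:R by rewrite sqr_sqrtr.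
have b2 : b ^+ 2 = n%:R by rewrite sqr_sqrtr.
have a0 : 0 < a by rewrite sqrtr_gt0 ltr0n (leq_ltn_trans _ nl).
have b1 : 1 <= b by rewrite -sqrtr1 ler_wsqrtr// ler1n.
have ab : b < a by rewrite ltr_sqrt ?ltr_nat ?ltr0n ?(leq_ltn_trans _ nl).
have -> : Num.sqrt (n%:R / l%:R) = b / a by rewrite sqrtrM// sqrtrV.
have -> : (3 + b / a) / (1 - b / a) = (3 * a + b) / (a - b).
  by field; rewrite ?subr_eq0 ?gt_eqF.
have mE := measurable_condX_ge ((3 * a + b) / (a - b)) n0 rA (gaussian_measurable_mx gOm).
have [ab2|ab2] := ltP a (b + 2).
  apply: (@le_trans _ _ 1%E); first exact: probability_le1 mE.
  (* The linear bound 1 - x <= exp(-x) gives 2 (1 - 4/8) = 1 exactly at a - b = 2, which is where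
     the cases are split. *)
  rewrite lee_fin; have := expR_ge1Dx (- ((a - b) ^+ 2 / 8)).
  nra.
have [Q [U [QQ AE _ _]]] := reduced_QR_exists rA.
have l0 : (0 < l)%N by exact: leq_ltn_trans nl.
have m0 : (0 < m)%N by exact: leq_trans nm.
have u1 : vnorm (delta_mx (Ordinal l0) 0 : 'cV[R]_l) = 1 by exact: delta_vnorm.
have x1 : vnorm (delta_mx (Ordinal m0) 0 : 'cV[R]_m) = 1 by exact: delta_vnorm.
have [p [e [e0 pln /(smin_tail gOm QQ u1 e0)]]] := smin_tail_numerics b1 ab2 a2 b2.
have [q /(smax_tail gOm QQ x1)] := smax_tail_numerics b1 ab2 a2 b2.
set g := expR (-1 - (a - b) / (a + b) / 4).
have g0 : 0 < g by exact: expR_gt0.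
set s := 2 * g * (a - b); set S := 99 / 100 * (2 * g * (3 * a + b)).
have s0 : 0 < s by rewrite /s; nra.
have S0 : 0 < S by rewrite /S; nra.
move=> /(_ S0) [E1 [mE1 PE1 hE1]] /(_ (ltW s0) pln) [E2 [mE2 PE2 hE2]].
apply: (@le_trans _ _ (P (E1 `|` E2))).
  apply: le_measure; rewrite ?inE//; first exact: measurableU.
  move=> w /= cw; apply: contrapT => /not_orP[/hE1 hi /hE2 lo].
  move: cw; apply/negP; rewrite -ltNge.
  apply: (condX_lt_of_bounds n0 rA QQ AE s0 (ltW S0) _ lo hi).
  (* The common factor 2 g cancels in the ratio of [S] and [s], leaving 99/100 of the threshold. *)
  have -> : (3 * a + b) / (a - b) * s = 2 * g * (3 * a + b).
    by rewrite /s; field; rewrite subr_eq0 gt_eqF.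
  by move: S0; rewrite /S; lra.
apply: (le_trans (measureU2 _ mE1 mE2)).
rewrite mulrDl mul1r EFinD.
exact: leeD.
Qed.
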